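(* Let $p$ be a prime number, let $r\ge 1$, and for each $i\in\{1,\dots,r\}$ let $n_i,m_i$ be non-zero integers with $0<n_i\le |m_i|$ and $(n_i,|m_i|)\neq(1,1)$. Let $$G=\langle a,t_1,\dots,t_r \mid t_i a^{n_i}t_i^{-1}=a^{m_i},\ i\in\{1,\dots,r\}\rangle .$$ Write $m_i=p^{\sigma_i}\hat m_i$ and $n_i=p^{\tau_i}\hat n_i$ with $\sigma_i,\tau_i\ge 0$ integers and $\hat m_i,\hat n_i$ integers not divisible by $p$. Let $d_i=\gcd(\hat m_i,\hat n_i)$, $\hat m_i=d_iu_i$, $\hat n_i=d_iv_i$ (so $\gcd(u_i,v_i)=1$). Define $\theta_i=\min\{\sigma_i,\tau_i\}$ if $\sigma_i\ne\tau_i$ or if ($\sigma_i=\tau_i$ and $p\nmid(\hat m_i-\hat n_i)$), and $\theta_i=\infty$ if $\sigma_i=\tau_i$ and $p\mid(\hat m_i-\hat n_i)$. Let $(N_p)_\omega(G)$ be the intersection of all normal subgroups of $G$ whose index is finite and a power of $p$. (1) If there exists $i\in\{1,\dots,r\}$ with $\theta_i\neq\infty$, then $(N_p)_\omega(G)=\langle a^{p^{\xi}}\rangle^G$, the normal closure of $a^{p^\xi}$ in $G$, where $\xi=\min\{\theta_i : 1\le i\le r\}$. (2) If $\theta_i=\infty$ for all $i\in\{1,\dots,r\}$, put $\Sigma=\sum_{i=1}^r\sigma_i$ and let $F_r$ be the (free) subgroup of $G$ generated by $t_1,\dots,t_r$. Then $(N_p)_\omega(G)$ is the normal closure in $G$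 of the set consisting of the following elements: (a) $[w,a^{p^\Sigma}]$ for all $w\in\gamma_2(F_r)$; (b) $[t_1^{k_1}\cdots t_r^{k_r}\,a\,t_r^{-k_r}\cdots t_1^{-k_1},\ a^{p^\Sigma}]$ for all $k_1,\dots,k_r\in\mathbb Z$; (c) $t_1^{k_1}\cdots t_r^{k_r}\,a^{p^\Sigma\frac{y_1\cdots y_r}{\delta}}\,t_r^{-k_r}\cdots t_1^{-k_1}\,a^{-p^\Sigma\frac{\bar y_1\cdots\bar y_r}{\delta}}$ for all $k_1,\dots,k_r\in\mathbb Z$, where, for given $k_1,\dots,k_r$, $$y_i=\begin{cases} v_i^{|k_i|} & k_i>0\\ u_i^{|k_i|} & k_i<0\\ 1& k_i=0\end{cases}\qquad \bar y_i=\begin{cases} u_i^{|k_i|} & k_i>0\\ v_i^{|k_i|} & k_i<0\\ 1& k_i=0\end{cases}\qquad \delta=\gcd(y_1\cdots y_r,\ \bar y_1\cdots\bar y_r).$$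
   Context: $\gamma_2(F)$ denotes the commutator subgroup of a group $F$, and $[x,y]$ denotes the commutator of $x$ and $y$. The gcd is taken positive. For a subset $S$ of $G$, the normal closure of $S$ is the smallest normal subgroup of $G$ containing $S$; $\langle g\rangle^G$ is the normal closure of $g$. The group $G$ is a multiple HNN-extension of the infinite cyclic group $\langle a\rangle$ with stable letters $t_1,\dots,t_r$. *)

(* Defs.v *)
From HB Require Import structures.
From mathcomp Require Import all_boot all_algebra.
From mathcomp Require Import generic_quotient.
From mathcomp Require Import boolp classical_sets cardinality.
Set Implicit Arguments.
Unset Strict Implicit.
Unset Printing Implicit Defensive.

Local Open Scope classical_set_scope.
Local Open Scope quotient_scope.
Local Open Scope group_scope.

(* A letter (x, false) stands for the generator x, and (x, true) for x^-1. *)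
Definition word (X : Type) := seq (X * bool).

Definition winv (X : Type) (w : word X) : word X :=
  rev [seq (l.1, ~~ l.2) | l <- w].

(* The smallest congruence on words that contains R and free cancellation. *)
Inductive pres_eq (X : Type) (R : word X -> word X -> Prop) :
    word X -> word X -> Prop :=
| pres_eq_refl w : pres_eq R w w
| pres_eq_sym w1 w2 : pres_eq R w1 w2 -> pres_eq R w2 w1
| pres_eq_trans w1 w2 w3 :
    pres_eq R w1 w2 -> pres_eq R w2 w3 -> pres_eq R w1 w3
| pres_eq_cat w1 w1' w2 w2' :
    pres_eq R w1 w1' -> pres_eq R w2 w2' -> pres_eq R (w1 ++ w2) (w1' ++ w2')
| pres_eq_cancel x b : pres_eq R [:: (x, b); (x, ~~ b)] [::]
| pres_eq_rel w1 w2 : R w1 w2 -> pres_eq R w1 w2.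

Section Presentation.
Variables (X : choiceType) (R : word X -> word X -> Prop).

Definition pres_rel : rel (word X) := fun w1 w2 => `[< pres_eq R w1 w2 >].

Lemma pres_rel_refl : reflexive pres_rel.
Proof. by move=> w; apply/asboolP; exact: pres_eq_refl. Qed.

Lemma pres_rel_sym : symmetric pres_rel.
Proof.
by move=> w1 w2; apply/asboolP/asboolP; exact: pres_eq_sym.
Qed.

Lemma pres_rel_trans : transitive pres_rel.
Proof.
move=> w2 w1 w3 /asboolP h1 /asboolP h2; apply/asboolP.
exact: pres_eq_trans h1 h2.
Qed.

Canonical pres_equiv :=
  EquivRel pres_rel pres_rel_refl pres_rel_sym pres_rel_trans.

(* The group < X | w1 = w2 whenever R w1 w2 >. *)
Definition presented := {eq_quot pres_equiv}.

HB.instance Definition _ := Choice.on presented.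

Definition pres_class (w : word X) : presented := \pi_presented w.

Definition pres_gen (x : X) : presented := pres_class [:: (x, false)].

Lemma pres_classP w1 w2 : pres_class w1 = pres_class w2 <-> pres_eq R w1 w2.
Proof.
split=> [/eqP|h]; first by rewrite eqmodE => /asboolP.
by apply/eqP; rewrite eqmodE; apply/asboolP.
Qed.

Lemma pres_class_repr (x : presented) : pres_class (repr x) = x.
Proof. exact: reprK. Qed.

Lemma pres_eq_repr w : pres_eq R (repr (pres_class w)) w.
Proof. by apply/pres_classP; exact: pres_class_repr. Qed.

Definition pres_one : presented := pres_class [::].
Definition pres_mul (x y : presented) : presented :=
  pres_class (repr x ++ repr y).
Definition pres_inv (x : presented) : presented := pres_class (winv (repr x)).

Lemma pres_mulE w1 w2 :
  pres_mul (pres_class w1) (pres_class w2) = pres_class (w1 ++ w2).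
Proof. by apply/pres_classP; apply: pres_eq_cat; exact: pres_eq_repr. Qed.

Lemma pres_eq_catV w : pres_eq R (w ++ winv w) [::].
Proof.
elim: w => [|[x b] w IH]; first exact: pres_eq_refl.
have -> : ((x, b) :: w) ++ winv ((x, b) :: w) =
          [:: (x, b)] ++ (w ++ winv w) ++ [:: (x, ~~ b)].
  by rewrite /winv /= rev_cons -cats1 !catA.
apply: pres_eq_trans (pres_eq_cancel R x b).
apply: (pres_eq_cat (pres_eq_refl R [:: (x, b)])).
exact: (pres_eq_cat IH (pres_eq_refl R [:: (x, ~~ b)])).
Qed.

Lemma winvK : involutive (@winv X).
Proof.
move=> w; rewrite /winv map_rev revK -map_comp -[RHS]map_id.
by apply: eq_map => -[x b]; rewrite /= negbK.
Qed.

Lemma pres_mulA : associative pres_mul.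
Proof.
move=> x y z; rewrite -(pres_class_repr x) -(pres_class_repr y).
by rewrite -(pres_class_repr z) !pres_mulE catA.
Qed.

Lemma pres_mul1 : left_id pres_one pres_mul.
Proof. by move=> x; rewrite -(pres_class_repr x) pres_mulE. Qed.

Lemma pres_mulr1 : right_id pres_one pres_mul.
Proof. by move=> x; rewrite -(pres_class_repr x) pres_mulE cats0. Qed.

Lemma pres_mulV : left_inverse pres_one pres_inv pres_mul.
Proof.
move=> x; rewrite -{2}(pres_class_repr x) pres_mulE; apply/pres_classP.
by rewrite -{2}(winvK (repr x)); exact: pres_eq_catV.
Qed.

Lemma pres_mulrV : right_inverse pres_one pres_inv pres_mul.
Proof.
move=> x; rewrite -{1}(pres_class_repr x) pres_mulE; apply/pres_classP.
exact: pres_eq_catV.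
Qed.

HB.instance Definition _ := isGroup.Build presented
  pres_mulA pres_mul1 pres_mulr1 pres_mulV pres_mulrV.

End Presentation.

Definition wpow (X : Type) (x : X) (k : int) : word X :=
  nseq `|k|%N (x, (k < 0)%R).

(* Generators are indexed by option 'I_r: None is a, and Some i is t_i. *)
Inductive hnn_rel (r : nat) (n m : 'I_r -> int) :
    word (option 'I_r) -> word (option 'I_r) -> Prop :=
| HnnRel i :
    hnn_rel n m
      ((Some i, false) :: wpow None (n i) ++ [:: (Some i, true)])
      (wpow None (m i)).

Definition hnn (r : nat) (n m : 'I_r -> int) : groupType :=
  presented (hnn_rel n m).

Definition hnn_a (r : nat) (n m : 'I_r -> int) : hnn n m :=
  pres_gen (hnn_rel n m) None.

Definition hnn_t (r : nat) (n m : 'I_r -> int) (i : 'I_r) : hnn n m :=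
  pres_gen (hnn_rel n m) (Some i).

Section Subgroups.
Variable G : groupType.
Implicit Types (S H N : set G) (g x : G).

Definition zpow x (k : int) : G :=
  match k with
  | Posz j => x ^+ j
  | Negz j => x ^- j.+1
  end.

Definition is_subgroup H :=
  [/\ H 1, (forall x y, H x -> H y -> H (x * y)) & forall x, H x -> H x^-1].

Definition is_normal N :=
  is_subgroup N /\ forall g x, N x -> N (g * x * g^-1).

Definition subgroup_gen S : set G := smallest is_subgroup S.

Definition normal_closure S : set G := smallest is_normal S.

Definition derived_subgroup H : set G :=
  subgroup_gen [set [~ x, y] | x in H & y in H].

Definition left_coset N g : set G := [set g * x | x in N].

Definition has_index N (k : nat) := (range (left_coset N) #= `I_k)%card.

(* (N_p)_omega(G); a finite p-power index is an index of the form p ^ e. *)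
Definition p_residual (p : nat) : set G :=
  \bigcap_(N in [set N | is_normal N /\ exists e, has_index N (p ^ e)%N]) N.

End Subgroups.

Arguments p_residual G p : clear implicits.

(* None encodes infinity. *)
Definition theta (p sigma tau : nat) (mh nh : int) : option nat :=
  if (sigma != tau) || ((sigma == tau) && ~~ (p%:Z %| (mh - nh)%R)%Z)
  then Some (minn sigma tau) else None.

Definition is_min_theta (I : Type) (th : I -> option nat) (xi : nat) :=
  (exists i, th i = Some xi) /\ (forall i j, th i = Some j -> (xi <= j)%N).

(* y_i is ysel u_i v_i k_i, and \bar y_i is ysel v_i u_i k_i. *)
Definition ysel (u v k : int) : int :=
  (if 0 < k then v ^+ `|k|%N else if k < 0 then u ^+ `|k|%N else 1)%R.

Section Generators.
Variables (r : nat) (G : groupType) (a : G) (t : 'I_r -> G).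

Definition tprod (k : 'I_r -> int) : G := \prod_(i < r) zpow (t i) (k i).

Definition gens_a (q : nat) : set G :=
  [set [~ w, a ^+ q] | w in derived_subgroup (subgroup_gen (range t))].

Definition gens_b (q : nat) : set G :=
  [set [~ tprod k * a * (tprod k)^-1, a ^+ q] | k in [set: 'I_r -> int]].

Definition gens_c (q : nat) (u v : 'I_r -> int) : set G :=
  [set x | exists k : 'I_r -> int,
    let y := (\prod_(i < r) ysel (u i) (v i) (k i))%R in
    let ybar := (\prod_(i < r) ysel (v i) (u i) (k i))%R in
    let delta := gcdz y ybar in
    x = tprod k * zpow a (q%:Z * (y %/ delta)%Z)%R * (tprod k)^-1
        * zpow a (- (q%:Z * (ybar %/ delta)%Z))%R].

End Generators.

(* Main.v *)
(* Let q be the power p^xi or p^Sigma.  The theorem combines three facts.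

   (i) If each relation is either trivial modulo a^q or reads t b^n' t^-1 = b^m' with b = a^(p^c),
   n' and m' prime to p and m' = n' mod p, then G / <<a^q>> is residually a finite p-group.
   Modulo a^q every element has a normal form a^(j0) t_(i1)^(k1) a^(j1) ... without pinches.
   G acts on words whose letters are pairs (i, x), with x a residue modulo a power of p: a
   translates the residues, and t_i^k scales them by (m'/n')^k and adds k times the word with its
   first letter removed when that letter is fixed by the i-th associated subgroup.  Functions on
   words of bounded length form a finite set on which G acts unipotently up to an affine p-group,
   so the image is a finite p-group; the constant coefficient of a reduced product of m syllables
   on a suitable word of length m is the product of the exponents k_l, as in a Magnus embedding.

   (ii) In a quotient of exponent p^e, t_i raises a^(p^sigma_i) to the power m'/n', which gives all
   inclusions into the residual.

   (iii) In the second case, modulo the generators (a), (b), (c) the conjugates of c = a^q commute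
   and are indexed by Z^r, and every finitely generated subgroup of their span is cyclic.  Hence
   an element of the residual, which lies in that span by (i), has a power that is a power c^B;
   since the residual contains no nontrivial power of a, B = 0. *)

Require Import Defs.
From HB Require Import structures.
From mathcomp Require Import all_boot all_algebra.
From mathcomp Require Import all_fingroup all_solvable finfield.
From mathcomp Require Import finmap generic_quotient.
From mathcomp Require Import boolp classical_sets cardinality functions.
From mathcomp Require Import zify ring.
Set Implicit Arguments.
Unset Strict Implicit.
Unset Printing Implicit Defensive.
Import GRing.Theory Num.Theory.

(** * Integer powers, morphisms and quotients *)

Section IntegerPowers.
Local Open Scope group_scope.
Variable G : groupType.
Implicit Types (x y g : G) (k l : int).

Lemma zpow0 x : zpow x 0%Z = 1. Proof. by []. Qed.

Lemma zpow1 x : zpow x 1%Z = x. Proof. by []. Qed.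

Lemma zpow_nat x (j : nat) : zpow x j%:Z = x ^+ j. Proof. by []. Qed.

Lemma zpowN1 x : zpow x (-1)%Z = x^-1. Proof. by []. Qed.

Lemma zpowN x k : zpow x (- k)%R = (zpow x k)^-1.
Proof. by case: k => [[|j]|j] //=; rewrite ?invg1 ?invgK. Qed.

Lemma zpowS x k : zpow x (k + 1)%R = zpow x k * x.
Proof.
case: k => [j|[|j]]; first by rewrite -PoszD addn1 /= expgSr.
  by rewrite /= mulVg.
have -> : (Negz j.+1 + 1)%R = Negz j by rewrite !NegzE; lia.
by rewrite /= [X in _ = X^-1 * _]expgS invgM mulgVK.
Qed.

Lemma zpowP x k : zpow x (k - 1)%R = zpow x k * x^-1.
Proof. by rewrite -{2}(subrK 1%R k) zpowS mulgK. Qed.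

Lemma zpowD x k l : zpow x (k + l)%R = zpow x k * zpow x l.
Proof.
elim/int_rect: l => [|j IH|j IH]; first by rewrite addr0 mulg1.
  by rewrite -addn1 PoszD addrA !zpowS IH mulgA.
by rewrite -addn1 PoszD opprD addrA !zpowP IH mulgA.
Qed.

Lemma zpow1g k : zpow (1 : G) k = 1.
Proof. by case: k => j /=; rewrite expg1n ?invg1. Qed.

Lemma zpowM x k l : zpow x (k * l)%R = zpow (zpow x k) l.
Proof.
elim/int_rect: l => [|j IH|j IH]; first by rewrite mulr0.
  by rewrite -addn1 PoszD mulrDr mulr1 zpowS zpowD IH.
by rewrite -addn1 PoszD opprD mulrDr mulrN1 zpowP zpowD IH !zpowN.
Qed.

Lemma zpow_commute x y k : commute x y -> commute x (zpow y k).
Proof.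
by move=> h; case: k => j /=; [|apply: commuteV]; exact: commuteX.
Qed.

Lemma zpowMg x y k : commute x y -> zpow (x * y) k = zpow x k * zpow y k.
Proof.
move=> h; case: k => j /=; rewrite expgMn // invgM.
by apply: commuteV; apply: commute_sym; apply: commuteV; exact: commuteX2.
Qed.

Lemma zpow_conj g x k : g * zpow x k * g^-1 = zpow (g * x * g^-1) k.
Proof.
elim/int_rect: k => [|j IH|j IH]; first by rewrite mulg1 mulgV.
  by rewrite -addn1 PoszD !zpowS -IH !mulgA mulgVK.
by rewrite -addn1 PoszD opprD !zpowP -IH !invgM invgK !mulgA mulgVK.
Qed.

Lemma zpow_hom (f : int -> G) :
  (forall k l, f (k + l)%R = f k * f l) -> forall k, f k = zpow (f 1%R) k.
Proof.
move=> fD; have f0 : f 0%R = 1.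
  by apply: (mulgI (f 0%R)); rewrite -fD addr0 mulg1.
elim/int_rect => [//|j IH|j IH]; first by rewrite -addn1 PoszD fD IH zpowS.
rewrite -addn1 PoszD opprD fD zpowP IH; congr (_ * _).
by apply: (mulgI (f 1%R)); rewrite -fD subrr f0 mulgV.
Qed.

Lemma zpow_dvd x k l : zpow x k = 1 -> (k %| l)%Z -> zpow x l = 1.
Proof. by move=> h /dvdzP[z ->]; rewrite mulrC zpowM h zpow1g. Qed.

Lemma zpow_eqmod x k l1 l2 :
  zpow x k = 1 -> (k %| (l1 - l2)%R)%Z -> zpow x l1 = zpow x l2.
Proof.
move=> h hk; by rewrite -(subrK l2 l1) zpowD (zpow_dvd h hk) mul1g.
Qed.

Lemma zpow_coprime x k l : zpow x k = 1 -> zpow x l = 1 -> coprimez k l -> x = 1.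
Proof.
move=> hk hl /coprimezP[[s t] /= st].
have -> : x = zpow x (s * k + t * l)%R by rewrite st.
by rewrite zpowD ![(_ * k)%R]mulrC ![(_ * l)%R]mulrC !zpowM hk hl !zpow1g mulg1.
Qed.

End IntegerPowers.

Section Morphisms.
Local Open Scope group_scope.
Variables (G H : groupType) (f : G -> H).
Hypothesis fM : {morph f : x y / x * y}.

Lemma morphg1 : f 1 = 1.
Proof. by apply: (mulgI (f 1)); rewrite -fM !mulg1. Qed.

Lemma morphgV x : f x^-1 = (f x)^-1.
Proof. by apply: (mulgI (f x)); rewrite -fM !mulgV morphg1. Qed.

Lemma morphgX x j : f (x ^+ j) = f x ^+ j.
Proof. by elim: j => [|j IH]; rewrite ?morphg1 // !expgS fM IH. Qed.

Lemma morphg_zpow x k : f (zpow x k) = zpow (f x) k.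
Proof. by case: k => j /=; rewrite ?morphgV morphgX. Qed.

Lemma morphgR x y : f [~ x, y] = [~ f x, f y].
Proof. by rewrite /commg /conjg !fM !morphgV. Qed.

Lemma morphg_conj g x : f (g * x * g^-1) = f g * f x * (f g)^-1.
Proof. by rewrite !fM morphgV. Qed.

Lemma kernel_is_normal : is_normal [set x | f x = 1]%classic.
Proof.
split=> [|g x /= h]; last by rewrite morphg_conj h mulg1 mulgV.
split=> [|x y /= h1 h2|x /= h]; first exact: morphg1.
  by rewrite fM h1 h2 mulg1.
by rewrite morphgV h invg1.
Qed.

End Morphisms.

Section NormalClosure.
Local Open Scope group_scope.
Local Open Scope classical_set_scope.
Variable G : groupType.
Implicit Types (S N : set G).

Lemma normal_closure_normal S : is_normal (normal_closure S).
Proof.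
split; first split.
- by move=> N [[[]]].
- by move=> x y hx hy N hN; case: (hN) => -[[_ h _] _] _; apply: h; [exact: hx|exact: hy].
- by move=> x hx N hN; case: (hN) => -[[_ _ h] _] _; apply: h; exact: hx.
- by move=> g x hx N hN; case: (hN) => -[_ h] _; apply: h; exact: hx.
Qed.

Lemma normal_closure_sub S N : is_normal N -> S `<=` N -> normal_closure S `<=` N.
Proof. by move=> hN hS x; apply. Qed.

Lemma sub_normal_closure S : S `<=` normal_closure S.
Proof. by move=> x hx N [_]; apply. Qed.

Lemma subgroup_gen_subgroup S : is_subgroup (subgroup_gen S).
Proof.
split.
- by move=> N [[]].
- by move=> x y hx hy N hN; case: (hN) => -[_ h _] _; apply: h; [exact: hx|exact: hy].
- by move=> x hx N hN; case: (hN) => -[_ _ h] _; apply: h; exact: hx.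
Qed.

Lemma sub_subgroup_gen S : S `<=` subgroup_gen S.
Proof. by move=> x hx N [_]; apply. Qed.

Lemma subgroup_gen_sub S N : is_subgroup N -> S `<=` N -> subgroup_gen S `<=` N.
Proof. by move=> hN hS x; apply. Qed.

Lemma subgroup_zpow N x k : is_subgroup N -> N x -> N (zpow x k).
Proof.
move=> [N1 NM NV] Nx; elim/int_rect: k => [//|j IH|j IH].
  by rewrite -addn1 PoszD zpowS; apply: NM.
by rewrite -addn1 PoszD opprD zpowP; apply: NM => //; apply: NV.
Qed.

End NormalClosure.

Section Quotient.
Local Open Scope group_scope.
Local Open Scope quotient_scope.
Variables (G : groupType) (N : set G).
Hypothesis Nnormal : is_normal N.

Let N1 : N 1. Proof. by case: Nnormal => -[]. Qed.
Let NM x y : N x -> N y -> N (x * y). Proof. by case: Nnormal => -[_ h _] _; apply: h. Qed.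
Let NV x : N x -> N x^-1. Proof. by case: Nnormal => -[_ _ h] _; apply: h. Qed.
Let NJ g x : N x -> N (g * x * g^-1). Proof. by case: Nnormal => _; apply. Qed.

Definition coset_rel : rel G := fun x y => `[< N (x * y^-1) >].

Lemma coset_rel_refl : reflexive coset_rel.
Proof. by move=> x; apply/asboolP; rewrite mulgV. Qed.

Lemma coset_rel_sym : symmetric coset_rel.
Proof.
by move=> x y; apply/asboolP/asboolP => /NV; rewrite invgM invgK.
Qed.

Lemma coset_rel_trans : transitive coset_rel.
Proof.
move=> y x z /asboolP h1 /asboolP h2; apply/asboolP.
by have := NM h1 h2; rewrite mulgA mulgVK.
Qed.

Canonical coset_equiv :=
  EquivRel coset_rel coset_rel_refl coset_rel_sym coset_rel_trans.

Definition quotient_group := {eq_quot coset_equiv}.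

HB.instance Definition _ := Choice.on quotient_group.

Definition quotient_class (x : G) : quotient_group := \pi_quotient_group x.

Lemma quotient_classP x y : quotient_class x = quotient_class y <-> N (x * y^-1).
Proof.
split=> [/eqP|h]; first by rewrite eqmodE => /asboolP.
by apply/eqP; rewrite eqmodE; apply/asboolP.
Qed.

Lemma quotient_class_repr (x : quotient_group) : quotient_class (repr x) = x.
Proof. exact: reprK. Qed.

Let qmul (x y : quotient_group) := quotient_class (repr x * repr y).
Let qinv (x : quotient_group) := quotient_class (repr x)^-1.

Let qmulE x y : qmul (quotient_class x) (quotient_class y) = quotient_class (x * y).
Proof.
have rP z : N (repr (quotient_class z) * z^-1).
  by apply/quotient_classP; exact: quotient_class_repr.
apply/quotient_classP; set x' := repr _; set y' := repr _.
have -> : x' * y' * (x * y)^-1 = x' * x^-1 * (x * (y' * y^-1) * x^-1).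
  by rewrite invgM !mulgA mulgVK.
by apply: NM; [exact: rP|apply: NJ; exact: rP].
Qed.

Let qmulA : associative qmul.
Proof.
move=> x y z; rewrite -(quotient_class_repr x) -(quotient_class_repr y).
by rewrite -(quotient_class_repr z) !qmulE mulgA.
Qed.

Let qmul1 : left_id (quotient_class 1) qmul.
Proof. by move=> x; rewrite -(quotient_class_repr x) qmulE mul1g. Qed.

Let qmulr1 : right_id (quotient_class 1) qmul.
Proof. by move=> x; rewrite -(quotient_class_repr x) qmulE mulg1. Qed.

Let qmulV : left_inverse (quotient_class 1) qinv qmul.
Proof. by move=> x; rewrite -{2}(quotient_class_repr x) qmulE mulVg. Qed.

Let qmulrV : right_inverse (quotient_class 1) qinv qmul.
Proof. by move=> x; rewrite -{1}(quotient_class_repr x) qmulE mulgV. Qed.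

HB.instance Definition _ := isGroup.Build quotient_group
  qmulA qmul1 qmulr1 qmulV qmulrV.

Lemma quotient_exists : exists (Q : groupType) (f : G -> Q),
  [/\ {morph f : x y / x * y}, forall y, exists x, f x = y
    & forall x, f x = 1 <-> N x].
Proof.
exists quotient_group, quotient_class; split.
- by move=> x y; rewrite [RHS]qmulE.
- by move=> y; exists (repr y); exact: quotient_class_repr.
- by move=> x; rewrite (quotient_classP x 1) invg1 mulg1.
Qed.

End Quotient.

(** * Normal subgroups of prime power index *)

Section FiniteCopy.
Variables (Q : groupType) (k : nat) (F : Q -> 'I_k) (F' : 'I_k -> Q).
Hypotheses (FK : cancel F F') (F'K : cancel F' F).

(** The alias takes the bijection as an argument because the finite structure put on it is built
    from that bijection. *)
Definition finite_copy of cancel F F' : Type := Q.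
Local Notation fQ := (finite_copy FK).

HB.instance Definition _ := Group.on fQ.
HB.instance Definition _ : isCountable fQ := CanIsCountable FK.
HB.instance Definition _ : isFinite fQ :=
  CanIsFinite (FK : @cancel 'I_k fQ F F').

Lemma bij_ord_expg_order (x : Q) : (x ^+ k = 1)%g.
Proof.
have <- : #|{: fQ}| = k.
  by rewrite -[RHS]card_ord; apply: bij_eq_card; exists F'; [exact: FK|exact: F'K].
have := @expg_cardG _ [set: fQ] (x : fQ) (finset.in_setT _).
by rewrite cardsT.
Qed.

End FiniteCopy.

Section Index.
Local Open Scope group_scope.
Local Open Scope classical_set_scope.
Variable G : groupType.

Lemma left_coset_eq (N : set G) x y : is_subgroup N ->
  left_coset N x = left_coset N y <-> N (x^-1 * y).
Proof.
move=> [N1 NM NV]; split=> [e|h].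
  have [z Nz <-] : left_coset N x y.
    by rewrite e; exists 1; rewrite ?mulg1.
  by rewrite mulgA mulVg mul1g.
rewrite /left_coset; apply/seteqP; split=> _ [z Nz <-].
  exists (y^-1 * x * z); last by rewrite !mulgA mulgV mul1g.
  by apply: NM => //; have := NV _ h; rewrite invgM invgK.
by exists (x^-1 * y * z); [exact: NM|rewrite !mulgA mulgV mul1g].
Qed.

(** The given bijection between cosets and ['I_k] turns G/N into a finite group of order [k], to
    which Lagrange's theorem applies. *)
Lemma has_index_expg (N : set G) k x :
  is_normal N -> has_index N k -> N (x ^+ k).
Proof.
move=> Nn /pcard_eqP/unsquash f.
have Ns : is_subgroup N by case: Nn.
have [Q [phi [phiM phiS phiK]]] := quotient_exists Nn.
pose s (y : Q) : G := projT1 (cid (phiS y)).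
have sK y : phi (s y) = y by rewrite /s; case: cid.
have fB y : (f (left_coset N (s y)) < k)%N.
  by have := @funS _ _ _ _ f (left_coset N (s y)) (ex_intro2 _ _ (s y) I erefl).
pose F (y : Q) : 'I_k := Ordinal (fB y).
have Finj : injective F.
  move=> y z /(congr1 val) /= e.
  have /left_coset_eq : left_coset N (s y) = left_coset N (s z).
    apply: (@inj _ _ _ f) => //; rewrite inE; first by exists (s y).
    by exists (s z).
  move=> /(_ Ns) /phiK; rewrite phiM (morphgV phiM) !sK => /eqP.
  by rewrite mulg_eq1 eqg_inv => /eqP.
have Fsurj (i : 'I_k) : exists y, F y = i.
  have [_ [g _ <-] e] := @surj _ _ _ _ f i (ltn_ord i).
  exists (phi g); apply: val_inj; rewrite /= -e; congr (f _).
  by apply/left_coset_eq => //; apply/phiK; rewrite phiM (morphgV phiM) sK mulVg.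
pose F' (i : 'I_k) : Q := projT1 (cid (Fsurj i)).
have F'K : cancel F' F by move=> i; rewrite /F'; case: cid.
have FK : cancel F F' by move=> y; apply: Finj; rewrite F'K.
by apply/phiK; rewrite (morphgX phiM) (bij_ord_expg_order FK F'K).
Qed.

End Index.

Section Residual.
Local Open Scope group_scope.
Variables (G : groupType) (gT : finGroupType) (f : G -> gT) (p : nat).
Hypotheses (p_pr : prime p) (fM : {morph f : x y / x * y}).
Hypothesis f_order : forall x, exists e, f x ^+ (p ^ e) = 1.

Let I : {set gT} := [set y | `[< exists x, f x = y >]].

Let IP y : y \in I <-> exists x, f x = y.
Proof. by rewrite /I finset.in_set; split => /asboolP. Qed.

Let I_group : group_set I.
Proof.
apply/group_setP; split; first by apply/IP; exists 1; exact: morphg1.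
move=> x y /IP[x' <-] /IP[y' <-].
by apply/IP; exists (x' * y'); rewrite fM.
Qed.

Let I_card : exists e, #|I| = (p ^ e)%N.
Proof.
pose IG := group I_group.
suff /p_natP[e] : p.-nat #|IG| by exists e.
apply/pnatP=> [|q q_pr qI]; first exact: cardG_gt0.
have [y yI yq] := Cauchy q_pr qI.
have /IP[x fx] := yI.
have [e] := f_order x; rewrite fx => /eqP; rewrite -order_dvdn yq => h.
by move: (Euclid_dvdX p e q_pr); rewrite h dvdn_prime2 // => /esym/andP[].
Qed.

(** By Cauchy's theorem the image of [f] is a finite p-group, so the kernel is one of the subgroups
    being intersected. *)
Lemma p_residual_ker g : p_residual G p g -> f g = 1.
Proof.
pose N := [set x | f x = 1]%classic; move=> hg; change (N g).
have Nn : is_normal N by exact: (kernel_is_normal fM).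
apply: hg; split => //; have [e Ie] := I_card; exists e.
have LE : range (left_coset N) =
    [set (fun y => [set x | f x = y]%classic) y | y in [set` I]]%classic.
  have cosetE x : left_coset N x = [set z | f z = f x]%classic.
    apply/seteqP; split=> [_ [z Nz <-]|z /= h] /=; first by rewrite fM Nz mulg1.
    exists (x^-1 * z)%g; last by rewrite mulgA mulgV mul1g.
    by rewrite /N /= fM (morphgV fM) h mulVg.
  apply/seteqP; split=> [_ [x _ <-]|_ [y /= yI <-]].
    exists (f x); last by rewrite cosetE.
    by apply/IP; exists x.
  by case/IP: yI => x <-; exists x => //; rewrite cosetE.
rewrite /has_index LE; apply: card_eq_trans.
  apply: inj_card_eq => y z /set_mem/IP[x <-] _ e1.
  by have : [set x | f x = z]%classic x by rewrite -e1.
suff -> : [set` I]%classic = [set` seq_fset tt (enum I)]%classic.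
  apply/card_eq_fsetP; rewrite size_seq_fset undup_id ?enum_uniq //.
  by rewrite -cardE.
by apply/seteqP; split=> x; rewrite /mkset seq_fsetE mem_enum.
Qed.

End Residual.

(** * The group [hnn n m] *)

Section Presentation.
Local Open Scope group_scope.
Variables (X : choiceType) (R : word X -> word X -> Prop).
Variables (Q : groupType) (h : X -> Q).

Definition word_eval (w : word X) : Q :=
  \prod_(l <- w) (if l.2 then (h l.1)^-1 else h l.1).

Lemma word_eval_cat w1 w2 : word_eval (w1 ++ w2) = word_eval w1 * word_eval w2.
Proof. exact: big_cat. Qed.

Lemma word_eval1 x b : word_eval [:: (x, b)] = if b then (h x)^-1 else h x.
Proof. exact: big_seq1. Qed.

Lemma word_eval_wpow x k : word_eval (wpow x k) = zpow (h x) k.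
Proof.
rewrite /wpow /word_eval big_nseq; case: k => j /=.
  by elim: j => [|j IH] //=; rewrite IH expgS.
rewrite -expVgn; elim: j => [|j IH]; first by rewrite /= mulg1 expg1.
by rewrite expgS -IH.
Qed.

Hypothesis hR : forall w1 w2, R w1 w2 -> word_eval w1 = word_eval w2.

Lemma pres_eq_eval w1 w2 : pres_eq R w1 w2 -> word_eval w1 = word_eval w2.
Proof.
elim=> //.
- by move=> u v w _ -> _ ->.
- by move=> u u' v v' _ hu _ hv; rewrite !word_eval_cat hu hv.
- move=> x b; rewrite -cat1s word_eval_cat !word_eval1 /word_eval big_nil.
  by case: b; rewrite /= ?mulVg ?mulgV.
Qed.

Definition pres_lift (g : presented R) : Q := word_eval (generic_quotient.repr g).

Lemma pres_lift_class w : pres_lift (pres_class R w) = word_eval w.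
Proof. by apply: pres_eq_eval; exact: pres_eq_repr. Qed.

Lemma pres_liftM : {morph pres_lift : x y / x * y}.
Proof.
move=> x y; rewrite -(pres_class_repr x) -(pres_class_repr y).
by rewrite [X in pres_lift X]pres_mulE !pres_lift_class word_eval_cat.
Qed.

End Presentation.

Section HNN.
Local Open Scope group_scope.
Variables (r : nat) (n m : 'I_r -> int).
Local Notation G := (hnn n m).
Local Notation a := (hnn_a n m).
Local Notation t := (hnn_t n m).
Local Notation cl := (pres_class (hnn_rel n m)).

Lemma hnn_lift (Q : groupType) (x : Q) (y : 'I_r -> Q) :
  (forall i, y i * zpow x (n i) * (y i)^-1 = zpow x (m i)) ->
  exists f : G -> Q,
    [/\ {morph f : g h / g * h}, f a = x & forall i, f (t i) = y i].
Proof.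
move=> rel; pose h o := if o is Some i then y i else x.
have hR w1 w2 : hnn_rel n m w1 w2 -> word_eval h w1 = word_eval h w2.
  case=> i; rewrite -cat1s !word_eval_cat !word_eval1 !word_eval_wpow /= mulgA.
  exact: rel.
exists (pres_lift h); split; first exact: pres_liftM.
  by rewrite /hnn_a /pres_gen pres_lift_class // word_eval1.
by move=> i; rewrite /hnn_t /pres_gen pres_lift_class // word_eval1.
Qed.

Let clM w1 w2 : cl (w1 ++ w2) = cl w1 * cl w2.
Proof. by rewrite -pres_mulE. Qed.

Let clV o : cl [:: (o, true)] = (cl [:: (o, false)])^-1.
Proof.
apply: (mulgI (cl [:: (o, false)])); rewrite mulgV -clM.
exact/pres_classP/pres_eq_cancel.
Qed.

Let cl_wpow o k : cl (wpow o k) = zpow (cl [:: (o, false)]) k.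
Proof.
rewrite /wpow; case: k => j /=.
  by elim: j => [|j IH] //=; rewrite -cat1s clM IH expgS.
rewrite -expVgn -clV; elim: j => [//|j IH].
by rewrite expgS -IH -clM.
Qed.

Lemma hnn_relation i : t i * zpow a (n i) * (t i)^-1 = zpow a (m i).
Proof.
rewrite -[RHS]cl_wpow.
have /pres_classP <- := pres_eq_rel (HnnRel n m i).
by rewrite -cat1s !clM clV cl_wpow mulgA.
Qed.

Lemma hnn_ind (P : G -> Prop) :
  P 1 -> (forall g, P g -> P (g * a)) -> (forall g, P g -> P (g * a^-1)) ->
  (forall g i, P g -> P (g * t i)) -> (forall g i, P g -> P (g * (t i)^-1)) ->
  forall g, P g.
Proof.
move=> P1 Pa PaV Pt PtV g; rewrite -(pres_class_repr g).
elim/last_ind: (generic_quotient.repr g) => [//|w [[i|] b] IH];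
  rewrite -cats1 clM; case: b; rewrite ?clV.
- exact: PtV.
- exact: Pt.
- exact: PaV.
- exact: Pa.
Qed.

Lemma hnn_morph_ext (Q : groupType) (f : G -> Q) (S : set Q) :
  {morph f : x y / x * y} -> is_subgroup S -> S (f a) -> (forall i, S (f (t i))) ->
  forall g, S (f g).
Proof.
move=> fM [S1 SM SV] Sa St; apply: hnn_ind.
- by rewrite (morphg1 fM).
- by move=> g Sg; rewrite fM; apply: SM.
- by move=> g Sg; rewrite fM (morphgV fM); apply: SM => //; apply: SV.
- by move=> g i Sg; rewrite fM; apply: SM.
- by move=> g i Sg; rewrite fM (morphgV fM); apply: SM => //; apply: SV.
Qed.

End HNN.

(** * Products of syllables and reduced products *)

Section Syllables.
Local Open Scope group_scope.
Variable r : nat.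

(* The list is read from the right end of the product: its head is the last syllable. *)
Fixpoint syl_eval (Q : groupType) (x : Q) (y : 'I_r -> Q) (j0 : int)
    (L : seq ('I_r * int * int)) : Q :=
  if L is (i, k, j) :: L' then syl_eval x y j0 L' * zpow (y i) k * zpow x j
  else zpow x j0.

(** [D i j] means that [a^j] can be moved past powers of [t_i]. Signs of exponents are irrelevant:
    modulo [a^q] the two associated subgroups of [t_i] coincide. *)
Fixpoint syl_reduced (D : 'I_r -> int -> bool) (L : seq ('I_r * int * int)) :=
  if L is (i, k, j) :: L' then
    [&& k != 0%R,
        (if L' is (i', _, j') :: _ then (i == i') ==> ~~ D i j' else true)
      & syl_reduced D L']
  else true.

Lemma syl_eval_morph (G Q : groupType) (f : G -> Q) x y j0 L :
  {morph f : g h / g * h} -> f (syl_eval x y j0 L) = syl_eval (f x) (f \o y) j0 L.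
Proof.
move=> fM; elim: L => [|[[i k] j] L IH] /=; first exact: morphg_zpow.
by rewrite !fM IH !(morphg_zpow fM).
Qed.

End Syllables.

(** * A representation of [hnn n m] by a finite p-group *)

Section Representation.
Local Open Scope ring_scope.
Variables (R : finComUnitRingType) (r M : nat).
Variables (lam : 'I_r -> R) (e : 'I_r -> nat) (pi : R).

Local Notation letter := ('I_r * R)%type.
(** A state (w, l, j) stands for the word [w] with each letter (i, x) replaced by (i, l x + j), so
    affine maps change only the pair (l, j). *)
Definition state := (M.-bseq letter * R * R)%type.
Implicit Type z : state.

Definition zword z : seq letter := z.1.1.
Definition shift (c : R) z : state := (z.1.1, z.1.2, z.2 + c).
Definition scale (c : R) z : state := (z.1.1, c * z.1.2, c * z.2).

(** The annihilator of [e i] plays the part of the [i]-th associated subgroup. *)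
Definition hit i (l j : R) (w : seq letter) :=
  if w is (i', x) :: _ then (i' == i) && ((l * x + j) *+ e i == 0) else false.
(** A letter is removed only if the next one is not hit as well. Thus [t_i] never removes two
    letters in a row, which makes [act_t i] additive in the exponent. *)
Definition pops i z :=
  hit i z.1.2 z.2 (zword z) && ~~ hit i z.1.2 z.2 (behead (zword z)).

Lemma size_behead_bseq (w : M.-bseq letter) : (size (behead w) <= M)%N.
Proof. by rewrite size_behead; apply: leq_trans (leq_pred _) (size_bseq w). Qed.

Definition pop z : state := (Bseq (size_behead_bseq z.1.1), z.1.2, z.2).

Local Notation V := {ffun state -> R}.
Implicit Type F : V.

Definition act_a (k : int) F : V := [ffun z => F (shift (pi *~ k) z)].
Definition act_t i (k : int) F : V :=
  [ffun z => F (scale (lam i ^ k) z)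
     + (if pops i z then F (scale (lam i ^ k) (pop z)) else 0) *~ k].

Lemma act_aD k l F : act_a (k + l) F = act_a l (act_a k F).
Proof.
apply/ffunP=> z; rewrite !ffunE; congr (F _); rewrite /shift /=.
by rewrite mulrzDr addrAC addrA.
Qed.

Lemma act_a0 F : act_a 0 F = F.
Proof. by apply/ffunP=> -[[w l] j]; rewrite ffunE /shift /= mulr0z addr0. Qed.

Lemma act_aK k : cancel (act_a k) (act_a (- k)).
Proof. by move=> F; rewrite -act_aD subrr act_a0. Qed.

Definition perm_a k : {perm V} := perm (can_inj (act_aK k)).

Lemma perm_aD k l : perm_a (k + l) = (perm_a k * perm_a l)%g.
Proof. by apply/permP=> F; rewrite permM !permE act_aD. Qed.

Lemma perm_aE k : zpow (perm_a 1) k = perm_a k.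
Proof. by rewrite -zpow_hom //; exact: perm_aD. Qed.

Hypothesis lamU : forall i, lam i \is a GRing.unit.

Lemma hit_scale c i l j w :
  c \is a GRing.unit -> hit i (c * l) (c * j) w = hit i l j w.
Proof.
move=> cU; case: w => [|[i' x] w] //=; congr (_ && _).
by rewrite -mulrA -mulrDr -mulrnAr -[in LHS](mulr0 c) (inj_eq (mulrI cU)).
Qed.

Lemma pops_scale c i z : c \is a GRing.unit -> pops i (scale c z) = pops i z.
Proof. by move=> cU; rewrite /pops /= !hit_scale. Qed.

Lemma pops_pop i z : pops i z -> pops i (pop z) = false.
Proof. by rewrite /pops => /andP[_ h]; rewrite /pops /= (negPf h). Qed.

Lemma act_tD i k l F : act_t i (k + l) F = act_t i l (act_t i k F).
Proof.
have scaleD z : scale (lam i ^ (k + l)) z = scale (lam i ^ k) (scale (lam i ^ l) z).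
  by rewrite exprzDr // /scale /= !mulrA.
apply/ffunP=> z; rewrite !ffunE !pops_scale ?unitrXz //.
case: ifP => [pz|_]; last by rewrite !mul0rz !addr0 scaleD.
by rewrite pops_pop // mul0rz addr0 !scaleD mulrzDr addrA.
Qed.

Lemma act_t0 i F : act_t i 0 F = F.
Proof.
by apply/ffunP=> -[[w l] j]; rewrite ffunE mulr0z addr0 expr0z /scale /= !mul1r.
Qed.

Lemma act_tK i k : cancel (act_t i k) (act_t i (- k)).
Proof. by move=> F; rewrite -act_tD subrr act_t0. Qed.

Definition perm_t i k : {perm V} := perm (can_inj (act_tK i k)).

Lemma perm_tD i k l : perm_t i (k + l) = (perm_t i k * perm_t i l)%g.
Proof. by apply/permP=> F; rewrite permM !permE act_tD. Qed.

Lemma perm_tE i k : zpow (perm_t i 1) k = perm_t i k.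
Proof. by rewrite -(zpow_hom (perm_tD i)). Qed.

Variables (n m : 'I_r -> int).
Hypothesis lamE : forall i, lam i * (pi *~ n i) = pi *~ m i.
Hypothesis piE : forall i, pi *~ n i *+ e i = 0.

Lemma pops_shift i z : pops i (shift (pi *~ n i) z) = pops i z.
Proof.
have hitE w : hit i z.1.2 (z.2 + pi *~ n i) w = hit i z.1.2 z.2 w.
  by case: w => [|[i' x] w] //=; rewrite addrA mulrnDl piE addr0.
by rewrite /pops /= !hitE.
Qed.

(** Scaling by [lam i] turns translation by [pi *~ n i] into translation by [pi *~ m i], and the
    former does not change which letters are hit. *)
Lemma perm_relation i :
  (perm_t i 1 * zpow (perm_a 1) (n i) * (perm_t i 1)^-1 = zpow (perm_a 1) (m i))%g.
Proof.
apply: (mulIg (perm_t i 1)); rewrite mulgVK !perm_aE.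
apply/permP=> F; rewrite !permM !permE; apply/ffunP=> z.
rewrite !ffunE pops_shift.
have E z' : scale (lam i ^ 1) (shift (pi *~ n i) z') =
    shift (pi *~ m i) (scale (lam i ^ 1) z').
  by rewrite /scale /shift /= expr1z mulrDr lamE.
by rewrite E; case: ifP => // _; rewrite -(E (pop z)).
Qed.

(** * Filtered permutations and their orders *)

Definition aff (al be : R) z : state := (z.1.1, al * z.1.2, al * z.2 + be).

(** Up to a term determined by values at shorter words, [f] is substitution of an affine map.
    Comparing two functions says this without requiring [f] to be linear. *)
Definition filtered al be (f : V -> V) := forall F F' z,
  (forall z', (size (zword z') < size (zword z))%N -> F z' = F' z') ->
  f F z - f F' z = F (aff al be z) - F' (aff al be z).

Lemma aff_aff al be al' be' z :
  aff al be (aff al' be' z) = aff (al * al') (al * be' + be) z.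
Proof. by rewrite /aff /=; congr (_, _, _); ring. Qed.

Lemma aff1 z : aff 1 0 z = z.
Proof. by case: z => [[w l] j]; rewrite /aff /= !mul1r addr0. Qed.

Lemma filtered_comp al be al' be' f g :
  filtered al be f -> filtered al' be' g ->
  filtered (al * al') (al * be' + be) (g \o f).
Proof.
move=> hf hg F F' z FF' /=; rewrite hg => [|z' lt_z'].
  by rewrite hf ?aff_aff // => z' lt_z'; apply: FF'.
apply/eqP; rewrite -subr_eq0 hf.
  by rewrite FF' ?subrr.
by move=> z'' lt_z''; apply: FF'; exact: ltn_trans lt_z'' lt_z'.
Qed.

Lemma filtered_id : filtered 1 0 id.
Proof. by move=> F F' z _; rewrite aff1. Qed.

Lemma filtered_perm1 : filtered 1 0 (1%g : {perm V}).
Proof. by move=> F F' z h; rewrite !perm1; exact: filtered_id. Qed.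

Lemma filtered_permM al be al' be' (s s' : {perm V}) :
  filtered al be s -> filtered al' be' s' ->
  filtered (al * al') (al * be' + be) (s * s')%g.
Proof.
by move=> h h' F F' z FF'; rewrite !permM; exact: (filtered_comp h h').
Qed.

Lemma filtered_permX al be (s : {perm V}) k :
  filtered al be s -> exists be', filtered (al ^+ k) be' (s ^+ k)%g.
Proof.
move=> h; elim: k => [|k [be' IH]]; first by exists 0; exact: filtered_perm1.
by eexists; rewrite expgS exprS; exact: filtered_permM h IH.
Qed.

Lemma filtered_permX1 be (s : {perm V}) k :
  filtered 1 be s -> filtered 1 (be *+ k) (s ^+ k)%g.
Proof.
move=> h; elim: k => [|k IH]; first exact: filtered_perm1.
rewrite expgS mulrSr; have := filtered_permM h IH.
by rewrite !mul1r.
Qed.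

Variables (p N : nat).
Hypotheses (p_gt0 : (0 < p)%N) (pN0 : (p ^ N)%:R = 0 :> R).

Definition one_mod_p (x : R) := exists mu, x = 1 + p%:R * mu.

(** If y is a multiple of p^(k+1), then (1 + y)^p = 1 + p y + y^2 c is 1 modulo p^(k+2). *)
Lemma one_mod_pX x k : one_mod_p x -> exists mu, x ^+ (p ^ k) = 1 + (p ^ k.+1)%:R * mu.
Proof.
case=> mu ->; elim: k => [|k [nu IH]]; first by exists mu; rewrite expn0 expn1 expr1.
have binom (y : R) j : exists c, (1 + y) ^+ j = 1 + j%:R * y + y ^+ 2 * c.
  elim: j => [|j [c IHj]]; first by exists 0; rewrite expr0; ring.
  by exists (j%:R + c + y * c); rewrite exprS IHj -natr1; ring.
rewrite expnSr exprM IH.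
have [c ->] := binom ((p ^ k.+1)%:R * nu) p.
exists (nu + (p ^ k)%:R * nu ^+ 2 * c).
by rewrite !expnS !natrM; ring.
Qed.

(** Induction on the word length: once [h] fixes all values at shorter words, each application of
    [h] adds the same amount to the value at [z], and p^N applications add zero. *)
Lemma filtered_unipotent (s : {perm V}) l : filtered 1 0 s ->
  exists b, forall F z, (size (zword z) < l)%N -> (s ^+ (p ^ b))%g F z = F z.
Proof.
move=> hs; elim: l => [|l [b IH]]; first by exists 0%N.
set h := (s ^+ (p ^ b))%g in IH.
have hh : filtered 1 0 h.
  by have := filtered_permX1 (p ^ b) hs; rewrite mul0rn.
exists (b + N)%N => F z; rewrite ltnS leq_eqVlt expnD expgnA -/h.
have fixb k F' z' : (size (zword z') < l)%N -> (h ^+ k)%g F' z' = F' z'.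
  move=> lt_z'; elim: k => [|k IHk]; first by rewrite perm1.
  by rewrite expgSr permM IH.
case/orP=> [/eqP zl|]; last exact: fixb.
have step k : (h ^+ k)%g F z = F z + (h F z - F z) *+ k.
  elim: k => [|k IHk]; first by rewrite perm1 addr0.
  have E : h ((h ^+ k)%g F) z - h F z = (h ^+ k)%g F z - F z.
    rewrite hh ?aff1 // => z'; rewrite zl => lt_z'; exact: fixb.
  rewrite expgSr permM; apply: (addIr (- h F z)); rewrite E IHk mulrS.
  by ring.
by rewrite step -mulr_natr pN0 mulr0 addr0.
Qed.

Definition filtered_p (s : {perm V}) :=
  exists al be, one_mod_p al /\ filtered al be s.

(** Three successive powers: the first makes the linear part 1, the second kills the translation,
    the third the unipotent part. *)
Lemma filtered_p_order s : filtered_p s -> exists b, (s ^+ (p ^ b))%g = 1%g.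
Proof.
case=> al [be [al1 hs]].
have [be1] := filtered_permX (p ^ N) hs.
have [mu ->] := one_mod_pX N al1.
rewrite expnS natrM pN0 mulr0 mul0r addr0 => hs1.
have := filtered_permX1 (p ^ N) hs1.
rewrite -mulr_natr pN0 mulr0 -expgnA -expnD => hs2.
have [b hb] := filtered_unipotent M.+1 hs2.
exists (N + N + b)%N; rewrite expnD expgnA; apply/permP=> F; apply/ffunP=> z.
by rewrite hb ?perm1 // ltnS; exact: size_bseq.
Qed.

Lemma filtered_pM s s' : filtered_p s -> filtered_p s' -> filtered_p (s * s')%g.
Proof.
move=> [al [be [[mu ->] hs]]] [al' [be' [[mu' ->] hs']]].
do 2!eexists; split; last exact: filtered_permM hs hs'.
by exists (mu + mu' + p%:R * mu * mu'); ring.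
Qed.

Lemma filtered_p_subgroup : is_subgroup filtered_p.
Proof.
have one : filtered_p 1%g.
  exists 1, 0; split; last exact: filtered_perm1.
  by exists 0; rewrite mulr0 addr0.
split=> // [|s hs]; first exact: filtered_pM.
have [b hb] := filtered_p_order hs.
(* The order is finite, so the inverse is a nonnegative power and closure under products
   suffices. *)
suff -> : (s^-1 = s ^+ (p ^ b).-1)%g.
  by elim: _.-1 => [//|k IH]; rewrite expgS; apply: filtered_pM.
apply: (mulgI s); rewrite mulgV -expgS.
by rewrite prednK ?expn_gt0 ?p_gt0.
Qed.

Lemma filtered_p_a k : filtered_p (perm_a k).
Proof.
exists 1, (pi *~ k); split; first by exists 0; rewrite mulr0 addr0.
by move=> F F' z _; rewrite !permE !ffunE /aff !mul1r.
Qed.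

Lemma filtered_p_t i k : one_mod_p (lam i ^ k) -> filtered_p (perm_t i k).
Proof.
move=> h; exists (lam i ^ k), 0; split=> // F F' z FF'.
have affE : aff (lam i ^ k) 0 z = scale (lam i ^ k) z by rewrite /aff addr0.
rewrite !permE !ffunE affE; case: ifP => [pz|_]; last by rewrite mul0rz !addr0.
(* A state that pops has a nonempty word, so popping shortens it strictly and [F], [F'] agree
   there. *)
rewrite [F (scale _ (pop z))]FF'; first by rewrite opprD addrACA subrr addr0.
rewrite /zword /= size_behead ltn_predL.
by case/andP: pz => + _; rewrite /hit /zword; case: (bseqval _).
Qed.

Lemma representation_exists : prime p -> (forall i, one_mod_p (lam i)) ->
  exists f : hnn n m -> {perm V},
    [/\ {morph f : g h / (g * h)%g}, f (hnn_a n m) = perm_a 1,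
        forall i, f (hnn_t n m i) = perm_t i 1
      & forall g, p_residual (hnn n m) p g -> f g = 1%g].
Proof.
move=> p_pr lam1; have [f [fM fa ft]] := hnn_lift perm_relation.
exists f; split=> // g; apply: p_residual_ker => // x.
apply: filtered_p_order; apply: (hnn_morph_ext fM filtered_p_subgroup).
  by rewrite fa; exact: filtered_p_a.
by move=> i; rewrite ft; apply: filtered_p_t; rewrite expr1z.
Qed.

(** * Reduced products acting on the indicator of the empty word *)

Variable D : 'I_r -> int -> bool.
Hypothesis piD : forall i j, pi *~ j *+ e i = 0 -> D i j.

Let delta0 : V := [ffun z => (size (zword z) == 0)%:R].

Let syl_cons i k j L j0 F z :
  syl_eval (perm_a 1) (perm_t^~ 1) j0 ((i, k, j) :: L) F z =
  let H := syl_eval (perm_a 1) (perm_t^~ 1) j0 L F in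
  let z1 := shift (pi *~ j) z in
  H (scale (lam i ^ k) z1)
   + (if pops i z1 then H (scale (lam i ^ k) (pop z1)) else 0) *~ k.
Proof. by rewrite /= perm_aE perm_tE !permM ![(perm _) _]permE !ffunE. Qed.

(** Each syllable removes at most one letter, so fewer syllables than letters never reach the empty
    word. *)
Lemma syl_delta0_long L j0 z : (size L < size (zword z))%N ->
  syl_eval (perm_a 1) (perm_t^~ 1) j0 L delta0 z = 0.
Proof.
elim: L z => [|[[i k] j] L IH] z Lz.
  by rewrite /= perm_aE permE !ffunE /zword /= eqn0Ngt Lz.
rewrite syl_cons /= IH ?(ltnW Lz) // add0r; case: ifP => _; last exact: mul0rz.
rewrite IH ?mul0rz // /zword /= size_behead.
by rewrite ltn_predRL.
Qed.

(** The word has one letter per syllable, chosen so that every syllable has to remove its own letter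
    and contributes its exponent as a factor. The clause on the first letter is the induction
    invariant: the power of [a] in the head syllable brings that letter to 0. *)
Lemma syl_delta0 L j0 : syl_reduced D L -> (size L <= M)%N ->
  exists z, [/\ size (zword z) = size L, z.1.2 \is a GRing.unit,
    (if L is (i, k, j) :: _ then
       exists x w, zword z = (i, x) :: w /\ z.1.2 * x + z.2 = - (pi *~ j)
     else True)
    & syl_eval (perm_a 1) (perm_t^~ 1) j0 L delta0 z =
      (\prod_(s <- L) s.1.2)%:~R].
Proof.
elim: L => [|[[i k] j] L IH] Lred LM.
  exists (Bseq (leq0n M : (size (nil : seq letter) <= M)%N), 1, 0).
  by rewrite unitr1 big_nil /= perm_aE permE !ffunE.
case/and3P: Lred => k0 iL Lred.
have [[[w' l'] j'] [/= szw' l'U topL valL]] := IH Lred (ltnW LM).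
pose c := lam i ^ k; have cU : c \is a GRing.unit by rewrite unitrXz.
(* Scaling by [c] takes the pair (l, b) to (l', j'), and [x] is the letter that (l, b) sends to
   0. *)
pose l := c^-1 * l'; pose b := c^-1 * j'; pose x := - (l^-1 * b).
have lU : l \is a GRing.unit by rewrite unitrM unitrV cU.
have lx : l * x + b = 0 by rewrite mulrN mulVKr // addNr.
have wP : (size ((i, x) :: w' : seq letter) <= M)%N by rewrite /= [size _]szw'.
exists (Bseq wP, l, b - pi *~ j); split=> //=; first by rewrite szw'.
  by exists x, w'; rewrite /= addrA lx add0r.
rewrite syl_cons /= syl_delta0_long ?add0r; last by rewrite /= szw'.
set z1 := shift _ _; have -> : pops i z1.
  rewrite /pops /= subrK eqxx lx mul0rn eqxx /=.
  case: L iL topL {IH Lred LM valL} szw' => [|[[i' k'] j''] L] iL topL szw'.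
    by move: szw'; rewrite /hit /zword /=; case: (bseqval w').
  (* If the next letter were hit too, the invariant would place its power of [a] in the associated
     subgroup of [t_i], against reducedness. *)
  have {topL} [x' [w'' [/= + e']]] := topL.
  rewrite /zword /= => ->; rewrite /hit; apply/negP=> /andP[/eqP ei /eqP h]; move: iL; rewrite ei eqxx /=.
  rewrite piD // -[pi *~ _]opprK -e'.
  have <- : c * (l * x' + b) = l' * x' + j' by rewrite /l /b -mulrA -mulrDr mulVKr.
  by rewrite mulNrn -mulrnAr h mulr0 oppr0.
have -> : scale (lam i ^ k) (pop z1) = (w', l', j').
  rewrite /scale /= subrK !mulVKr // -/c; congr (_, _, _); exact: val_inj.
by rewrite valL big_cons mulrC intrM mulrzr.
Qed.

(** For nonempty [L], [delta0] vanishes at the state just constructed, while the product would give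
    the nonzero product of exponents. For empty [L], the indicator of offset 0 detects the
    translation. *)
Lemma syl_eval_eq1 L j0 : syl_reduced D L -> (size L <= M)%N ->
  (\prod_(s <- L) s.1.2)%:~R != 0 :> R ->
  syl_eval (perm_a 1) (perm_t^~ 1) j0 L = 1%g -> L = [::] /\ pi *~ j0 = 0.
Proof.
move=> Lred LM L0 ev1.
have [z [szz _ _]] := syl_delta0 j0 Lred LM.
rewrite ev1 perm1 ffunE szz; case: L ev1 L0 {Lred LM szz} => [|x L] ev1 L0 /= zE.
  split=> //; pose F : V := [ffun z => (z.2 == 0)%:R].
  pose z0 : state := (Bseq (leq0n M : (size (nil : seq letter) <= M)%N), 1, 0).
  have := congr1 (fun s : {perm V} => s F z0) ev1.
  rewrite /= perm_aE permE perm1 !ffunE /= add0r eqxx.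
  by case: eqP => // _ /esym/eqP; rewrite oner_eq0.
by rewrite -zE eqxx in L0.
Qed.

End Representation.

(** * Integers modulo a prime power, and conjugation of elements of p-power order *)

Section ResiduesModPrimePower.
Local Open Scope ring_scope.

Lemma Zp_int_eq0 (q : nat) (z : int) :
  (1 < q)%N -> (z%:~R == 0 :> 'Z_q) = (q%:Z %| z)%Z.
Proof.
move=> q1; have nat0 (j : nat) : (j%:R == 0 :> 'Z_q) = (q %| j)%N.
  by rewrite -val_eqE /= val_Zp_nat.
case: z => j; first by rewrite -pmulrn nat0 dvdzE.
by rewrite NegzE mulrNz oppr_eq0 -pmulrn nat0 dvdzE.
Qed.

Lemma coprimez_pexp (p e : nat) (z : int) :
  prime p -> ~~ (p%:Z %| z)%Z -> coprimez (p ^ e)%N%:Z z.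
Proof.
move=> p_pr; rewrite dvdzE /= => h.
by rewrite coprimezE /= coprimeXl // prime_coprime.
Qed.

Lemma Zp_int_unit (p e : nat) (z : int) : prime p -> (0 < e)%N ->
  ~~ (p%:Z %| z)%Z -> (z%:~R : 'Z_(p ^ e)) \is a GRing.unit.
Proof.
move=> p_pr e0 pz; have q1 : (1 < p ^ e)%N by rewrite -(exp1n e) ltn_exp2r ?prime_gt1.
have /coprimezP[[s t] /= st] := coprimez_pexp e p_pr pz.
apply/unitrP; exists (t%:~R); rewrite -!intrM [z * t]mulrC.
suff -> : (t * z)%:~R = 1 :> 'Z_(p ^ e) by [].
apply/eqP; rewrite -subr_eq0 -(intrB _ _ 1) Zp_int_eq0 //.
by rewrite -st opprD addrCA subrr addr0 -mulNr dvdz_mull.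
Qed.

End ResiduesModPrimePower.

Section PowerConjugation.
Local Open Scope group_scope.
Variables (Q : groupType) (p e : nat).
Hypothesis p_pr : prime p.

(** With [k] an inverse of [n] modulo p^e, [b] is the [k]-th power of b^n, so l = m k. *)
Lemma conj_zpow_coprime (b t : Q) (n m : int) :
  b ^+ (p ^ e) = 1 -> t * zpow b n * t^-1 = zpow b m -> ~~ (p%:Z %| n)%Z ->
  exists l, t * b * t^-1 = zpow b l /\ ((p ^ e)%N%:Z %| (l * n - m)%R)%Z.
Proof.
move=> be tb pn; have /coprimezP[[s k] /= sk] := coprimez_pexp e p_pr pn.
exists (m * k)%R; split.
  rewrite zpowM -tb -zpow_conj -zpowM [(n * k)%R]mulrC.
  congr (_ * _ * _); rewrite -[LHS]zpow1; apply: (zpow_eqmod (k := (p ^ e)%N%:Z) be).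
  have -> : (1%:Z - k * n = s * (p ^ e)%N%:Z)%R by apply/eqP; rewrite subr_eq sk.
  exact: dvdz_mull.
have -> : (m * k * n - m = - (m * s * (p ^ e)%N%:Z))%R.
  by rewrite -[X in (_ - X)%R]mulr1 -sk; ring.
by rewrite -mulNr dvdz_mull.
Qed.

End PowerConjugation.

(** * Normal forms without pinches *)

Section NormalForm.
Local Open Scope group_scope.
Variables (r : nat) (n m : 'I_r -> int).
Variables (Q : groupType) (f : hnn n m -> Q).
Hypothesis fM : {morph f : g h / g * h}.
Variable D : 'I_r -> int -> bool.

Local Notation x := (f (hnn_a n m)).
Local Notation y := (fun i => f (hnn_t n m i)).

Hypothesis swap : forall i j k, D i j ->
  exists j', zpow x j * zpow (y i) k = zpow (y i) k * zpow x j'.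

Let nf g := exists j0 L, syl_reduced D L /\ f g = syl_eval x y j0 L.

Let nf_a j0 L k : syl_reduced D L -> exists j1 L',
  syl_reduced D L' /\ syl_eval x y j0 L * zpow x k = syl_eval x y j1 L'.
Proof.
case: L => [|[[i l] j] L] Lred; first by exists (j0 + k)%R, [::]; rewrite /= zpowD.
by exists j0, ((i, l, j + k)%R :: L); rewrite /= zpowD mulgA.
Qed.

(** Either [t_i^k] opens a new syllable, or the power of [a] before it moves to the right and two
    powers of [t_i] merge. If these cancel, that power of [a] is absorbed by what remains on the
    left. *)
Let nf_t j0 L i k : (k != 0)%R -> syl_reduced D L -> exists j1 L',
  syl_reduced D L' /\ syl_eval x y j0 L * zpow (y i) k = syl_eval x y j1 L'.
Proof.
move=> k0 Lred.
have new : (if L is (i', _, j') :: _ then (i == i') ==> ~~ D i j' else true) ->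
  exists j1 L', syl_reduced D L' /\
    syl_eval x y j0 L * zpow (y i) k = syl_eval x y j1 L'.
  move=> h; exists j0, ((i, k, 0)%R :: L); split; first exact/and3P.
  by rewrite /= mulg1.
case: L Lred new => [|[[i' l] j] L] Lred; first exact.
case: (boolP ((i == i') ==> ~~ D i j)) => [_ /(_ isT)|+ _] //.
rewrite negb_imply negbK => /andP[/eqP ei Dij]; subst i'.
have [j' sw] := swap k Dij; case/and3P: Lred => l0 iL Lred.
have E : syl_eval x y j0 ((i, l, j) :: L) * zpow (y i) k =
    syl_eval x y j0 L * zpow (y i) (l + k)%R * zpow x j'.
  by rewrite /= zpowD -!mulgA sw.
rewrite E; case: (eqVneq (l + k)%R 0%R) => [->|lk0].
  by rewrite zpow0 mulg1; exact: nf_a.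
by exists j0, ((i, l + k, j')%R :: L); split=> //; exact/and3P.
Qed.

Lemma hnn_normal_form g : nf g.
Proof.
have step h z w : f z = w -> (forall j0 L, syl_reduced D L -> exists j1 L',
    syl_reduced D L' /\ syl_eval x y j0 L * w = syl_eval x y j1 L') ->
    nf h -> nf (h * z).
  by move=> zw H [j0 [L [Lred hL]]]; rewrite /nf fM hL zw; exact: H.
elim/hnn_ind: g => [|g|g|g i|g i].
- by exists 0%R, [::]; rewrite (morphg1 fM).
- by apply: (step _ _ (zpow x 1%R)) => // j0 L; exact: nf_a.
- by apply: (step _ _ (zpow x (-1)%R)) => [|j0 L]; [exact: morphgV|exact: nf_a].
- by apply: (step _ _ (zpow (y i) 1%R)) => // j0 L; exact: nf_t.
- by apply: (step _ _ (zpow (y i) (-1)%R)) => [|j0 L]; [exact: morphgV|exact: nf_t].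
Qed.

End NormalForm.

(** * The residual lies in the normal closure of a^(p^s) *)

Section ResidualOfTorsionQuotient.
Local Open Scope group_scope.
Variables (p r : nat) (n m : 'I_r -> int).
Hypothesis p_pr : prime p.
Local Notation G := (hnn n m).
Local Notation a := (hnn_a n m).
Local Notation t := (hnn_t n m).

Lemma slope_exists (N : nat) (nh mh : int) : (0 < N)%N ->
  ~~ (p%:Z %| nh)%Z -> (p%:Z %| (mh - nh)%R)%Z ->
  exists lam : 'Z_(p ^ N),
    [/\ lam \is a GRing.unit, one_mod_p p lam & (lam * nh%:~R = mh%:~R)%R].
Proof.
move=> N0 pn /dvdzP[k mnE].
have pm : ~~ (p%:Z %| mh)%Z.
  by apply: contra pn => pm; rewrite -(subKr mh nh) mnE rpredB // dvdz_mull.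
have nU : (nh%:~R : 'Z_(p ^ N))%R \is a GRing.unit by exact: Zp_int_unit.
exists (mh%:~R / nh%:~R)%R; split; last by rewrite mulrVK.
  by rewrite unitrM unitrV nU andbT; exact: Zp_int_unit.
exists (k%:~R / nh%:~R)%R; apply: (mulIr nU); rewrite mulrVK // mulrDl mulrA mulrVK //.
by rewrite mul1r -(subrK nh mh) mnE addrC intrD intrM [(k%:~R * _)%R]mulrC.
Qed.

Variables (s : nat) (c : 'I_r -> nat).
Hypothesis cs : forall i, (c i <= s)%N.
Hypothesis slope : forall i,
  [/\ c i = s, ((p ^ s)%N%:Z %| n i)%Z & ((p ^ s)%N%:Z %| m i)%Z] \/
  exists nh mh, [/\ n i = ((p ^ c i)%N%:Z * nh)%R, m i = ((p ^ c i)%N%:Z * mh)%R,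
                    ~~ (p%:Z %| nh)%Z & (p%:Z %| (mh - nh)%R)%Z].

Let D i (j : int) := ((p ^ c i)%N%:Z %| j)%Z.

(** When the relation is trivial, the powers of [a] concerned are 1. Otherwise b = a^(p^(c i)) has
    p-power order and [nh], [mh] are prime to p, so [t_i] and its inverse both conjugate b to powers
    of b. *)
Let swap_mod (Q : groupType) (f : G -> Q) : {morph f : g h / g * h} ->
  f (a ^+ (p ^ s)) = 1 -> forall i j k, D i j ->
  exists j', zpow (f a) j * zpow (f (t i)) k = zpow (f (t i)) k * zpow (f a) j'.
Proof.
move=> fM fa i j k Dij; set x := f a; set y := f (t i).
have xs : x ^+ (p ^ s) = 1 by rewrite -(morphgX fM).
suff conj1 j1 : D i j1 ->
    (exists2 j', D i j' & y * zpow x j1 * y^-1 = zpow x j') /\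
    (exists2 j', D i j' & y^-1 * zpow x j1 * y = zpow x j').
  suff [j' _ E] : exists2 j', D i j' & (zpow y k)^-1 * zpow x j * zpow y k = zpow x j'.
    by exists j'; rewrite -E !mulgA mulgV mul1g.
  elim/int_rect: k => [|k [j' Dj' E]|k [j' Dj' E]].
  - by exists j; rewrite // invg1 mul1g mulg1.
  - have [_ [j'' Dj'' E']] := conj1 _ Dj'; exists j'' => //.
    by rewrite -addn1 PoszD zpowS -E' -E invgM !mulgA.
  - have [[j'' Dj'' E'] _] := conj1 _ Dj'; exists j'' => //.
    by rewrite -addn1 PoszD opprD zpowP -E' -E invgM invgK !mulgA.
case: (slope i) => [[ci _ _]|[nh [mh [nE mE pn pmn]]]].
  move=> Dj1; have -> : zpow x j1 = 1.
    by apply: (zpow_dvd (k := (p ^ s)%N%:Z) xs); rewrite -ci.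
  by split; exists 0%R; rewrite ?mulg1 ?mulgV ?mulVg // /D dvdz0.
pose b := zpow x (p ^ c i)%N%:Z.
have bp : b ^+ (p ^ (s - c i)) = 1.
  by rewrite /b /= -expgnA -expnD subnKC.
have yb : y * zpow b nh * y^-1 = zpow b mh.
  rewrite /b -!zpowM -nE -mE -!(morphg_zpow fM) -(morphg_conj fM).
  by rewrite hnn_relation.
have yVb : y^-1 * zpow b mh * y^-1^-1 = zpow b nh.
  by rewrite -yb invgK !mulgA mulVg mul1g mulgVK.
have pm : ~~ (p%:Z %| mh)%Z.
  by apply: contra pn => pm; rewrite -(subKr mh nh) rpredB.
have [l [bl _]] := conj_zpow_coprime p_pr bp yb pn.
have [l' [bl' _]] := conj_zpow_coprime p_pr bp yVb pm.
move=> /dvdzP[h ->]; rewrite [(h * _)%R]mulrC zpowM -/b.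
split; [exists ((p ^ c i)%N%:Z * (l * h))%R | exists ((p ^ c i)%N%:Z * (l' * h))%R];
  rewrite ?/D ?dvdz_mulr // [RHS]zpowM -/b [RHS]zpowM.
  by rewrite zpow_conj bl.
by rewrite -bl' -zpow_conj invgK.
Qed.

Lemma p_residual_sub_closure g :
  p_residual G p g -> normal_closure [set a ^+ (p ^ s)]%classic g.
Proof.
move=> gres; set K := normal_closure _.
have Kn : is_normal K by exact: normal_closure_normal.
have [Q [f [fM _ fK]]] := quotient_exists Kn.
have fas : f (a ^+ (p ^ s)) = 1 by apply/fK; apply: sub_normal_closure.
have [j0 [L [Lred gE]]] := hnn_normal_form fM (swap_mod fM fas) g.
pose P := (\prod_(x <- L) x.1.2)%R.
have P0 : P != 0%R.
  rewrite /P; elim: L Lred {gE P} => [|[[i k] j] L IH]; first by rewrite big_nil.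
  by case/and3P=> k0 _ Lred; rewrite big_cons mulf_neq0 // IH.
(* This makes p^N larger than the absolute value of [P], so [P] stays nonzero modulo p^N. *)
pose N := (s + `|P|.+1)%N.
have N0 : (0 < N)%N by rewrite /N addnS.
have q1 : (1 < p ^ N)%N by rewrite -(exp1n N) ltn_exp2r ?prime_gt1.
(* With this translation, [a^j] acts trivially exactly when p^s divides j. *)
pose pi : 'Z_(p ^ N) := (p ^ (N - s))%:R%R.
have sN : (s <= N)%N by exact: leq_addr.
have piZ z : (pi *~ z = ((p ^ (N - s))%N%:Z * z)%:~R)%R.
  by rewrite /pi -mulrzr intrM -pmulrn.
have pi_s : (pi *~ (p ^ s)%N%:Z = 0)%R.
  apply/eqP; rewrite piZ Zp_int_eq0 // -PoszM -expnD subnK //.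
(* The annihilator p^(s - c i) kills [pi *~ j] exactly when p^(c i) divides j, which is [D i j].
   Trivial relations get the scaling factor 1. *)
have lam_ex i : exists lam : 'Z_(p ^ N), [/\ lam \is a GRing.unit, one_mod_p p lam,
    (lam * (pi *~ n i) = pi *~ m i)%R & (pi *~ n i *+ p ^ (s - c i) = 0)%R].
  case: (slope i) => [[ci /dvdzP[k nE] /dvdzP[l mE]]|[nh [mh [nE mE pn pmn]]]].
    exists 1%R; rewrite unitr1 nE mE ![(_ * (p ^ s)%N%:Z)%R]mulrC !mulrzA pi_s.
    rewrite !mul0rz mulr0 mul0rn; split=> //.
    by exists 0%R; rewrite mulr0 addr0.
  have [lam [lamU lam1 lamE]] := slope_exists N0 pn pmn.
  exists lam; split=> //.
    rewrite nE mE !mulrzA -[(_ *~ nh)%R]mulrzr -[(_ *~ mh)%R]mulrzr -lamE.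
    by rewrite mulrCA.
  rewrite nE pmulrn -mulrzA mulrAC -PoszM -expnD subnKC //.
  by rewrite mulrzA pi_s mul0rz.
have [lam lamP] := choice lam_ex.
have [lamU lam1 lamE piE] : [/\ forall i, lam i \is a GRing.unit,
    forall i, one_mod_p p (lam i), forall i, (lam i * (pi *~ n i) = pi *~ m i)%R
    & forall i, (pi *~ n i *+ p ^ (s - c i) = 0)%R].
  by split=> i; case: (lamP i).
have pN0 : ((p ^ N)%:R = 0 :> 'Z_(p ^ N))%R.
  by apply/eqP; rewrite (Zp_int_eq0 (p ^ N)%N%:Z) // dvdzz.
have piD i j : (pi *~ j *+ p ^ (s - c i) = 0)%R -> D i j.
  move/eqP; rewrite pmulrn -mulrzA piZ Zp_int_eq0 //.
  have -> : (p ^ N = p ^ (N - s) * p ^ (s - c i) * p ^ c i)%N.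
    by rewrite -!expnD; congr (_ ^ _)%N; have := cs i; lia.
  rewrite !PoszM mulrA mulrAC dvdz_mul2l //.
  by rewrite mulf_neq0 // eqz_nat -lt0n expn_gt0 prime_gt0.
have [F [FM Fa Ft Fres]] := representation_exists (size L) lamU lamE piE
  (prime_gt0 p_pr) pN0 p_pr lam1.
(* The normal form, lifted to [G], equals [g] only modulo [K]. Since [F] kills [K] and the residual,
   it kills [g']. *)
pose g' := syl_eval a t j0 L.
have KF : (K `<=` [set h | F h = 1])%classic.
  apply: normal_closure_sub; first exact: kernel_is_normal.
  move=> _ -> /=; rewrite (morphgX FM) Fa -[LHS]/(zpow _ (p ^ s)%N%:Z) perm_aE.
  apply/permP=> X; apply/ffunP=> z; rewrite permE perm1 ffunE /shift pi_s addr0.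
  by case: z => [[]].
have Fg' : F g' = 1.
  have : F (g^-1 * g') = 1.
    apply: KF; apply/fK; rewrite fM (morphgV fM) gE /g' (syl_eval_morph _ _ _ _ fM).
    by rewrite mulVg.
  by rewrite FM (morphgV FM) (Fres g gres) invg1 mul1g.
have PN : (P%:~R != 0 :> 'Z_(p ^ N))%R.
  rewrite Zp_int_eq0 //; apply/negP; rewrite dvdzE /= => /dvdn_leq.
  rewrite absz_gt0 P0 => /(_ isT); rewrite leqNgt => /negP; apply.
  apply: (@leq_trans (p ^ `|P|.+1)).
    by apply: leq_trans (ltn_expl _ (prime_gt1 p_pr)) _; rewrite leq_exp2l ?prime_gt1.
  by rewrite leq_exp2l ?prime_gt1 // leq_addl.
have FtE : F \o t = (perm_t (size L) (fun i => p ^ (s - c i))%N lamU)^~ 1%R.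
  by apply: funext => i /=; exact: Ft.
rewrite /g' (syl_eval_morph _ _ _ _ FM) Fa FtE in Fg'.
have [L0 pij] := syl_eval_eq1 piD Lred (leqnn _) PN Fg'.
apply/fK; rewrite gE L0 /=; apply: (zpow_dvd (k := (p ^ s)%N%:Z) _).
  by rewrite /= -(morphgX fM).
move/eqP: pij; rewrite piZ Zp_int_eq0 //.
have -> : (p ^ N = p ^ (N - s) * p ^ s)%N by rewrite -expnD subnK.
rewrite PoszM dvdz_mul2l //.
by rewrite eqz_nat -lt0n expn_gt0 prime_gt0.
Qed.

End ResidualOfTorsionQuotient.

(** * Elements of the p-residual *)

Section ResidualMembers.
Local Open Scope group_scope.
Variables (p : nat) (G : groupType).
Hypothesis p_pr : prime p.

Lemma p_residual_normal : is_normal (p_residual G p).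
Proof.
split; first split.
- by move=> N [[[]]].
- by move=> x y hx hy N hN; case: (hN) => -[[_ h _] _] _; apply: h; [exact: hx|exact: hy].
- by move=> x hx N hN; case: (hN) => -[[_ _ h] _] _; apply: h; exact: hx.
- by move=> g x hx N hN; case: (hN) => -[_ h] _; apply: h; exact: hx.
Qed.

(** A quotient of order p^e has exponent dividing p^e. The exponent is raised to p^(e+1) so that p
    divides it even for the trivial quotient. *)
Lemma p_residual_intro g :
  (forall (Q : groupType) (f : G -> Q) e, {morph f : x y / x * y} ->
     (forall x : Q, x ^+ (p ^ e.+1) = 1) -> f g = 1) -> p_residual G p g.
Proof.
move=> H N [Nn [e Ne]].
have [Q [f [fM fS fK]]] := quotient_exists Nn.
apply/fK; apply: (H Q f e fM) => x; have [y <-] := fS x.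
rewrite expnSr expgnA -(morphgX fM).
by have /fK -> := has_index_expg y Nn Ne; rewrite expg1n.
Qed.

(** By Fermat's little theorem, l^(p^e) = l modulo p. *)
Lemma expz_pexp_dvd (l : int) e :
  (p%:Z %| (l ^+ (p ^ e) - 1)%R)%Z -> (p%:Z %| (l - 1)%R)%Z.
Proof.
have Fp0 (z : int) : (z%:~R == 0 :> 'F_p)%R = (p%:Z %| z)%Z.
  by rewrite Zp_int_eq0 ?pdiv_id // prime_gt1 // pdiv_id.
rewrite -!Fp0 !intrB !subr_eq0 rmorphXn /=.
suff -> : ((l%:~R : 'F_p) ^+ (p ^ e) = l%:~R)%R by [].
elim: e => [|e IH]; first by rewrite expr1.
rewrite expnSr exprM IH.
by have := expf_card (l%:~R : 'F_p)%R; rewrite card_Fp.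
Qed.

(** Conjugation by [t] is b -> b^l with l n = m modulo p. Iterated p^(e+1) times it is the identity,
    so b is killed by l^(p^(e+1)) - 1, which is l - 1 modulo p and hence prime to p. *)
Lemma conj_zpow_trivial (Q : groupType) e (b t : Q) (n m : int) :
  (forall x : Q, x ^+ (p ^ e.+1) = 1) -> t * zpow b n * t^-1 = zpow b m ->
  ~~ (p%:Z %| n)%Z -> ~~ (p%:Z %| (m - n)%R)%Z -> b = 1.
Proof.
move=> expQ tb pn pmn.
have [l [bl ln]] := conj_zpow_coprime p_pr (expQ b) tb pn.
have iter_conj k : t ^+ k * b * (t ^+ k)^-1 = zpow b (l ^+ k)%R.
  elim: k => [|k IH]; first by rewrite invg1 mulg1 mul1g.
  by rewrite expgS invgM exprS zpowM -bl -zpow_conj -IH !mulgA.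
have := iter_conj (p ^ e.+1)%N; rewrite expQ invg1 mulg1 mul1g => b_eq.
have b1 : zpow b (l ^+ (p ^ e.+1) - 1)%R = 1 by rewrite zpowP -b_eq mulgV.
apply: (zpow_coprime (k := (p ^ e.+1)%N%:Z) (expQ b) b1).
apply: coprimez_pexp => //; apply: contra pmn => /expz_pexp_dvd pl.
have -> : (m - n = (l - 1) * n - (l * n - m))%R by ring.
rewrite rpredB ?dvdz_mulr //; apply: dvdz_trans ln.
by rewrite dvdzE /= expnS dvdn_mulr.
Qed.

End ResidualMembers.

(** * Elements that conjugate [c] to a power of itself *)

Section Multipliers.
Local Open Scope group_scope.
Variables (Q : groupType) (c : Q) (P : int).
Hypothesis cP : zpow c P = 1.
Implicit Types (g h : Q) (l k : int).

Definition scales l g := g * c * g^-1 = zpow c l.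

Lemma scales1 : scales 1%R 1.
Proof. by rewrite /scales invg1 mulg1 mul1g. Qed.

Lemma scalesM l k g h : scales l g -> scales k h -> scales (l * k)%R (g * h).
Proof. by move=> hg hh; rewrite /scales zpowM -hg -zpow_conj -hh invgM !mulgA. Qed.

(** Integer multipliers commute, so g h and h g conjugate [c] to the same element. *)
Lemma scales_commute l k g h : scales l g -> scales k h -> commute [~ g, h] c.
Proof.
move=> hg hh; rewrite /commute.
have -> : [~ g, h] = (h * g)^-1 * (g * h) by rewrite invgM -!mulgA.
have E : g * h * c * (g * h)^-1 = h * g * c * (h * g)^-1.
  by rewrite [LHS](scalesM hg hh) [RHS](scalesM hh hg) mulrC.
have {}E : g * h * c = h * g * c * (h * g)^-1 * (g * h) by rewrite -E mulgVK.
by move: (h * g) (g * h) E => z w E; rewrite -mulgA E -!mulgA mulKg.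
Qed.

(** The multiplier is the fraction yb / y modulo [P], written without division. *)
Definition scales_ratio g (y yb : int) :=
  exists2 l, scales l g & (P %| (l * y - yb)%R)%Z.

Lemma scales_ratio1 : scales_ratio 1 1 1.
Proof. by exists 1%R; [exact: scales1|rewrite subrr dvdz0]. Qed.

Lemma scales_ratioM g h y yb z zb :
  scales_ratio g y yb -> scales_ratio h z zb ->
  scales_ratio (g * h) (y * z)%R (yb * zb)%R.
Proof.
move=> [l hg hl] [k hh hk]; exists (l * k)%R; first exact: scalesM.
have -> : (l * k * (y * z) - yb * zb =
  (l * y - yb) * (k * z) + yb * (k * z - zb))%R by ring.
by apply: rpredD; [exact: dvdz_mulr|exact: dvdz_mull].
Qed.

Lemma scales_ratioX g y yb j :
  scales_ratio g y yb -> scales_ratio (g ^+ j) (y ^+ j)%R (yb ^+ j)%R.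
Proof.
move=> h; elim: j => [|j IH]; first exact: scales_ratio1.
by rewrite expgS !exprS; exact: scales_ratioM.
Qed.

Lemma scales_ratio_zpow g (u v k : int) :
  scales_ratio g v u -> scales_ratio g^-1 u v ->
  scales_ratio (zpow g k) (ysel u v k) (ysel v u k).
Proof.
move=> h hV; case: k => [[|j]|j]; first exact: scales_ratio1.
  exact: scales_ratioX.
by rewrite /= -expVgn; exact: scales_ratioX.
Qed.

Lemma scales_ratio_tprod r (y : 'I_r -> Q) (u v k : 'I_r -> int) :
  (forall i, scales_ratio (y i) (v i) (u i)) ->
  (forall i, scales_ratio (y i)^-1 (u i) (v i)) ->
  scales_ratio (tprod y k) (\prod_i ysel (u i) (v i) (k i))%R
                           (\prod_i ysel (v i) (u i) (k i))%R.
Proof.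
move=> h hV.
rewrite /tprod; elim/big_ind3: _ => //.
- exact: scales_ratio1.
- by move=> *; exact: scales_ratioM.
- by move=> i _; exact: scales_ratio_zpow.
Qed.

(** The gcd divides [y], so it is prime to [P] and cancels from the congruence. *)
Lemma scales_ratio_conj g y yb : scales_ratio g y yb -> coprimez P y ->
  g * zpow c (y %/ gcdz y yb)%Z * g^-1 = zpow c (yb %/ gcdz y yb)%Z.
Proof.
case=> l hg hl Py; set d := gcdz y yb.
have yE : (y = (y %/ d)%Z * d)%R by rewrite divzK ?dvdz_gcdl.
have ybE : (yb = (yb %/ d)%Z * d)%R by rewrite divzK ?dvdz_gcdr.
have Pd : coprimez P d by move: Py; rewrite {1}yE coprimezMr => /andP[].
rewrite zpow_conj hg -zpowM; apply: (zpow_eqmod cP).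
by rewrite -(Gauss_dvdzl _ Pd) mulrBl -mulrA -yE -ybE.
Qed.

End Multipliers.

Lemma theta_None (p sigma tau : nat) (mh nh : int) :
  theta p sigma tau mh nh = None -> sigma = tau /\ (p%:Z %| (mh - nh)%R)%Z.
Proof.
rewrite /theta; case: eqP => //= -> h; split=> //.
by case: ifP h => // /negbFE.
Qed.

Lemma tprod_subgroup (G : groupType) r (t : 'I_r -> G) k (N : set G) :
  is_subgroup N -> (forall i, N (t i)) -> N (tprod t k).
Proof.
move=> Ns Nt; case: (Ns) => N1 NM _; rewrite /tprod; elim/big_ind: _ => // i _.
exact: subgroup_zpow.
Qed.

Lemma commute_conj (G : groupType) (g x y : G) :
  commute x y -> commute (g * x * g^-1)%g (g * y * g^-1)%g.
Proof. by move=> xy; rewrite /commute !mulgA !mulgVK -!(mulgA g) xy. Qed.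

(** * Powers of [a] and the elements (a), (b), (c) in the residual *)

Section HNNResidualMembers.
Local Open Scope group_scope.
Variables (p r : nat) (n m : 'I_r -> int).
Hypothesis p_pr : prime p.
Variables (sigma tau : 'I_r -> nat) (mh nh : 'I_r -> int).
Hypotheses (hm : forall i, m i = ((p ^ sigma i)%N%:Z * mh i)%R)
  (hn : forall i, n i = ((p ^ tau i)%N%:Z * nh i)%R)
  (hpm : forall i, ~~ (p%:Z %| mh i)%Z) (hpn : forall i, ~~ (p%:Z %| nh i)%Z).
Local Notation G := (hnn n m).
Local Notation a := (hnn_a n m).
Local Notation t := (hnn_t n m).
Local Notation th i := (theta p (sigma i) (tau i) (mh i) (nh i)).

(** For b = a^(p^j) the relation conjugates one power of b to another, with exponents whose
    difference is prime to p, and this forces b = 1 in every quotient of p-power exponent. *)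
Lemma theta_residual i j : th i = Some j -> p_residual G p (a ^+ (p ^ j)).
Proof.
move=> thi; apply: p_residual_intro => // Q f e fM expQ.
set x := f a; set y := f (t i); rewrite (morphgX fM) -/x.
have yx : y * zpow x (n i) * y^-1 = zpow x (m i).
  by rewrite -!(morphg_zpow fM) -(morphg_conj fM) hnn_relation.
have p_dvd (k : nat) (z : int) : (0 < k)%N -> (p%:Z %| ((p ^ k)%N%:Z * z)%R)%Z.
  by case: k => // k _; rewrite expnS PoszM -mulrA dvdz_mulr.
move: thi; rewrite /theta.
case: (ltngtP (sigma i) (tau i)) => [st|st|st] //=.
- case=> <-; set b := _ ^+ _.
  (* Here [n i] carries the higher power of p. The relation is inverted so that the exponent prime
     to p stands on the conjugated side. *)
  have yb : y^-1 * zpow b (mh i) * y^-1^-1 =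
      zpow b ((p ^ (tau i - sigma i))%N%:Z * nh i)%R.
    rewrite /b -zpow_nat -!zpowM mulrA -PoszM -expnD subnKC 1?ltnW // -hn -hm.
    by rewrite -yx invgK !mulgA mulVg mul1g mulgVK.
  apply: (conj_zpow_trivial p_pr expQ yb) => //.
  apply: contra (hpm i) => h.
  rewrite -(subKr ((p ^ (tau i - sigma i))%N%:Z * nh i)%R (mh i)).
  by rewrite rpredB // p_dvd ?subn_gt0.
- case=> <-; set b := _ ^+ _.
  have yb : y * zpow b (nh i) * y^-1 =
      zpow b ((p ^ (sigma i - tau i))%N%:Z * mh i)%R.
    by rewrite /b -zpow_nat -!zpowM mulrA -PoszM -expnD subnKC 1?ltnW // -hn -hm.
  apply: (conj_zpow_trivial p_pr expQ yb) => //.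
  apply: contra (hpn i) => h.
  rewrite -(subKr ((p ^ (sigma i - tau i))%N%:Z * mh i)%R (nh i)).
  by rewrite rpredB // p_dvd ?subn_gt0.
- case: ifP => // pmn [<-].
  rewrite st; set b := _ ^+ _.
  have yb : y * zpow b (nh i) * y^-1 = zpow b (mh i).
    by rewrite /b -zpow_nat -!zpowM -hn -st -hm.
  exact: (conj_zpow_trivial p_pr expQ yb).
Qed.

Hypothesis th0 : forall i, th i = None.
Variables (d u v : 'I_r -> int).
Hypotheses (hu : forall i, mh i = (d i * u i)%R) (hv : forall i, nh i = (d i * v i)%R).
Local Notation Sigma := (\sum_(i < r) sigma i)%N.

Lemma sigma_le_sum i : (sigma i <= Sigma)%N.
Proof. by rewrite (bigD1 i) //= leq_addr. Qed.

Lemma d_ndvd i : ~~ (p%:Z %| d i)%Z.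
Proof. by apply: contra (hpm i) => h; rewrite hu dvdz_mulr. Qed.

Lemma ysel_coprime e k : coprimez (p ^ e)%N%:Z (\prod_i ysel (u i) (v i) (k i))%R.
Proof.
have cop z i : z = u i \/ z = v i -> coprimez (p ^ e)%N%:Z z.
  move=> h; apply: coprimez_pexp => //; case: h => ->.
    by apply: contra (hpm i) => h; rewrite hu dvdz_mull.
  by apply: contra (hpn i) => h; rewrite hv dvdz_mull.
elim/big_ind: _ => [|y z hy hz|i _].
- by rewrite coprimezE coprimen1.
- by rewrite coprimezMr hy.
- rewrite /ysel; case: ifP => _; first by apply: coprimezXr; apply: (cop _ i); right.
  by case: ifP => _; [apply: coprimezXr; apply: (cop _ i); left|rewrite coprimezE coprimen1].
Qed.

(** In a quotient of p-power exponent every [t_i] acts on [c] with multiplier u_i / v_i. Commuting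
    multipliers give (a), their product gives (c). For (b), [c] is a conjugate by the product of the
    [t_i^(k_i)] of a power of [a]. *)
Lemma gens_residual :
  (gens_a a t (p ^ Sigma) `|` gens_b a t (p ^ Sigma) `|` gens_c a t (p ^ Sigma) u v
     `<=` p_residual G p)%classic.
Proof.
move=> g hg; apply: p_residual_intro => // Q f e fM expQ.
set x := f a; pose c := x ^+ (p ^ Sigma); pose P := Posz (p ^ e.+1).
have cP : zpow c P = 1 by exact: expQ.
(* Cancelling [d i], which is prime to p, passes from mh / nh to u / v. *)
have zP (z : 'I_r * int) : (P %| (d z.1 * z.2)%R)%Z = (P %| z.2)%Z.
  rewrite mulrC Gauss_dvdzl //; apply: coprimez_pexp => //; exact: d_ndvd.
have ratio i : scales_ratio c P (f (t i)) (v i) (u i) /\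
               scales_ratio c P (f (t i))^-1 (u i) (v i).
  set y := f (t i); pose b := x ^+ (p ^ sigma i).
  have [st _] := theta_None (th0 i).
  have cb : c = zpow b (p ^ (Sigma - sigma i))%N%:Z.
    by rewrite /c /b /= -expgnA -expnD subnKC // sigma_le_sum.
  have yb : y * zpow b (nh i) * y^-1 = zpow b (mh i).
    rewrite /b -zpow_nat -!zpowM -hm {1}st -hn -!(morphg_zpow fM).
    by rewrite -(morphg_conj fM) hnn_relation.
  have yVb : y^-1 * zpow b (mh i) * y^-1^-1 = zpow b (nh i).
    by rewrite -yb invgK !mulgA mulVg mul1g mulgVK.
  have [l [bl hl]] := conj_zpow_coprime p_pr (expQ b) yb (hpn i).
  have [l' [bl' hl']] := conj_zpow_coprime p_pr (expQ b) yVb (hpm i).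
  split; [exists l | exists l'].
  - by rewrite /scales cb zpow_conj bl -!zpowM mulrC.
  - by rewrite -(zP (i, _)) /= mulrBr mulrCA -hu -hv.
  - by rewrite /scales cb zpow_conj bl' -!zpowM mulrC.
  - by rewrite -(zP (i, _)) /= mulrBr mulrCA -hu -hv.
have ratioT k : scales_ratio c P (tprod (f \o t) k)
    (\prod_i ysel (u i) (v i) (k i))%R (\prod_i ysel (v i) (u i) (k i))%R.
  by apply: scales_ratio_tprod => i; case: (ratio i).
have fT k : f (tprod t k) = tprod (f \o t) k.
  rewrite /tprod (big_morph f fM (morphg1 fM)).
  by apply: eq_bigr => i _; exact: morphg_zpow.
have fc : f (a ^+ (p ^ Sigma)) = c by exact: morphgX.
pose S' := [set g | (exists l, scales c l (f g)) /\
                    (exists l, scales c l (f g)^-1)]%classic.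
have S'sub : is_subgroup S'.
  split=> [|g1 g2 /= [[l1 h1] [k1 h1']] [[l2 h2] [k2 h2']]|g1 /= [h1 h2]].
  + by rewrite /S' /= (morphg1 fM) invg1; split; exists 1%R; exact: scales1.
  + rewrite /S' /= fM invgM; split; first by exists (l1 * l2)%R; exact: scalesM.
    by exists (k2 * k1)%R; exact: scalesM.
  + by rewrite /S' /= (morphgV fM) invgK.
have S't : (range t `<=` S')%classic.
  by move=> _ [i _ <-]; have [[l hl _] [l' hl' _]] := ratio i; split; [exists l|exists l'].
case: hg => [[[w wF <-]|[k _ <-]]|[k ->]].
- rewrite (morphgR fM) fc; apply/eqP/commgP.
  pose S := [set w | commute (f w) c]%classic.
  suff : S w by [].
  have Ssub : is_subgroup S.
    split=> [|g1 g2 /= h1 h2|g1 /= h1]; rewrite /S /= ?(morphg1 fM) ?fM ?(morphgV fM).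
    + exact: commute_sym (commute1 _).
    + by apply: commute_sym; apply: commuteM; apply: commute_sym.
    + by apply: commute_sym; apply: commuteV; apply: commute_sym.
  apply: (subgroup_gen_sub Ssub) wF => _ [g1 Fg [g2 Fh <-]].
  rewrite /S /= (morphgR fM).
  have [[l hl] _] := subgroup_gen_sub S'sub S't Fg.
  have [[l' hl'] _] := subgroup_gen_sub S'sub S't Fh.
  exact: scales_commute hl hl'.
- rewrite (morphgR fM) fc (morphg_conj fM) fT; apply/eqP/commgP.
  have [_ [l hl]] := tprod_subgroup k S'sub (fun i => S't _ (ex_intro2 _ _ i I erefl)).
  move: hl; rewrite fT /scales invgK; set T := tprod _ _ => hl.
  have -> : c = T * zpow c l * T^-1 by rewrite -hl !mulgA mulgV mul1g mulgK.
  apply: commute_conj; apply: zpow_commute; exact: (commuteX _ (commute_refl x)).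
- rewrite !fM (morphgV fM) !(morphg_zpow fM) fT zpowN; apply/eqP.
  rewrite mulg_eq1 invgK; apply/eqP; rewrite !zpowM.
  exact: (scales_ratio_conj cP (ratioT k) (ysel_coprime _ _)).
Qed.

End HNNResidualMembers.

(** * The case of infinite theta *)

Section ConjugationModule.
Local Open Scope group_scope.
Variables (Q : groupType) (r q : nat) (x : Q) (y : 'I_r -> Q) (u v : 'I_r -> int).
Local Notation c := (x ^+ q).
Local Notation F := (subgroup_gen (range y)).
Implicit Types (f g h : Q) (k : 'I_r -> int).

Hypotheses (u0 : forall i, u i != 0%R) (v0 : forall i, v i != 0%R).
Hypothesis derived_c : forall g h, F g -> F h -> commute [~ g, h] c.
Hypothesis conj_x_c : forall k, commute (tprod y k * x * (tprod y k)^-1) c.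
Local Notation num k := (\prod_(i < r) ysel (v i) (u i) (k i))%R.
Local Notation den k := (\prod_(i < r) ysel (u i) (v i) (k i))%R.
Hypothesis ratio_c : forall k,
  tprod y k * zpow c (den k %/ gcdz (den k) (num k))%Z * (tprod y k)^-1
    = zpow c (num k %/ gcdz (den k) (num k))%Z.

Let cj g := g * c * g^-1.

Let cjM g h : cj (g * h) = g * cj h * g^-1.
Proof. by rewrite /cj invgM !mulgA. Qed.

Let F1 : F 1. Proof. by case: (subgroup_gen_subgroup (range y)). Qed.
Let FM g h : F g -> F h -> F (g * h).
Proof. by case: (subgroup_gen_subgroup (range y)) => _ FM _; apply: FM. Qed.
Let FV g : F g -> F g^-1.
Proof. by case: (subgroup_gen_subgroup (range y)) => _ _; apply. Qed.
Let Fy i l : F (zpow (y i) l).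
Proof.
apply: (subgroup_zpow _ (subgroup_gen_subgroup _)).
by apply: sub_subgroup_gen; exists i.
Qed.

(** The commutator of g and h, conjugated by f, is a commutator of elements of [F] and so
    centralises [c]. *)
Let cj_swap g h f : F g -> F h -> F f -> cj (g * h * f) = cj (h * g * f).
Proof.
move=> Fg Fh Ff; have FJ z : F z -> F (z ^ f) by move=> Fz; apply: FM => //; [exact: FV|exact: FM].
have := derived_c (FJ _ Fg) (FJ _ Fh); rewrite -conjRg => E.
have -> : g * h * f = h * g * f * [~ g, h] ^ f by rewrite -[RHS]mulgA -conjgC mulgA -commgC.
by rewrite cjM /cj E mulgK.
Qed.

Let P s k := \prod_(i <- s) zpow (y i) (k i).
Let FP s k : F (P s k).
Proof. by rewrite /P; elim/big_ind: _ => //. Qed.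

(** Conjugates of [c] see [F] only through its abelianisation, so exponents add generator by
    generator. *)
Let cj_add s k k' f : F f ->
  cj (P s (fun i => k i + k' i)%R * f) = cj (P s k * P s k' * f).
Proof.
move=> Ff; elim: s => [|i s IH]; first by rewrite /P !big_nil mulg1.
have PE k1 : P (i :: s) k1 = zpow (y i) (k1 i) * P s k1 by rewrite /P big_cons.
rewrite !PE zpowD -!mulgA 2!cjM [in LHS]IH -2!cjM mulgA -mulgA.
set A := zpow _ (k i); set B := zpow _ (k' i).
rewrite [LHS](_ : _ = cj (A * (B * P s k * (P s k' * f)))); last by rewrite !mulgA.
rewrite cjM cj_swap //; [|exact: Fy|exact: FM].
by rewrite -cjM !mulgA.
Qed.

Definition conj_c k := cj (tprod y k).

Let tprodE k : tprod y k = P (index_enum _) k. Proof. by []. Qed.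

Lemma conj_c0 : conj_c (fun=> 0%R) = c.
Proof. by rewrite /conj_c /tprod big1 // /cj invg1 mulg1 mul1g. Qed.

Lemma conj_cD k k' :
  conj_c (fun i => k i + k' i)%R = tprod y k * conj_c k' * (tprod y k)^-1.
Proof.
rewrite /conj_c -cjM -[tprod y (fun _ => _)]mulg1 -[_ * tprod y k']mulg1 !tprodE.
exact: cj_add.
Qed.

Lemma conj_cB k k' :
  tprod y k' * conj_c (fun i => k i - k' i)%R * (tprod y k')^-1 = conj_c k.
Proof. by rewrite -conj_cD; congr conj_c; apply: funext => i; rewrite addrC subrK. Qed.

(** Conjugation by the product with exponents -k takes [conj_c k] back to [c], where [conj_x_c]
    applies. *)
Lemma commute_x_conj_c k : commute x (conj_c k).
Proof.
pose k' i := (- k i)%R.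
have E : tprod y k' * conj_c k * (tprod y k')^-1 = c.
  by rewrite -conj_cD -conj_c0; congr conj_c; apply: funext => i; rewrite addNr.
have := commute_conj (tprod y k')^-1 (conj_x_c k'); rewrite -{1}E invgK.
by rewrite !mulgA mulVg !mul1g !mulgVK.
Qed.

Lemma commute_conj_c k k' : commute (conj_c k) (conj_c k').
Proof.
rewrite -(conj_cB k k'); apply: commute_conj.
by apply: commuteX; apply: commute_sym; exact: commute_x_conj_c.
Qed.

Definition slope_rat k : rat := (\prod_(i < r) ((u i)%:~R / (v i)%:~R) ^ (k i))%R.

Let uv_neq0 i : ((u i)%:~R / (v i)%:~R != 0 :> rat)%R.
Proof. by rewrite mulf_neq0 ?invr_eq0 ?intr_eq0. Qed.

Lemma slope_rat_neq0 k : slope_rat k != 0%R.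
Proof. by apply/prodf_neq0 => i _; rewrite expfz_neq0. Qed.

Lemma slope_ratD k k' : slope_rat (fun i => k i + k' i)%R = (slope_rat k * slope_rat k')%R.
Proof. by rewrite /slope_rat -big_split; apply: eq_bigr => i _; rewrite expfzDr. Qed.

Lemma slope_ratE k : (slope_rat k * (den k)%:~R = (num k)%:~R)%R.
Proof.
rewrite !rmorph_prod -big_split; apply: eq_bigr => i _ /=.
have [hu hv] : ((u i)%:~R != 0 :> rat)%R /\ ((v i)%:~R != 0 :> rat)%R.
  by rewrite !intr_eq0.
rewrite /ysel; case: (k i) => [[|j]|j] /=.
- by rewrite expr0z mulr1.
- by rewrite !rmorphXn /= -exprnP expr_div_n mulfVK // expf_neq0.
- rewrite !rmorphXn /= NegzE -exprnN expr_div_n invf_div mulfVK //.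
  by rewrite expf_neq0.
Qed.

Let den_neq0 k : den k != 0%R.
Proof.
apply/prodf_neq0 => i _; rewrite /ysel; case: ifP => _; first by rewrite expf_neq0.
by case: ifP => // _; rewrite expf_neq0.
Qed.

(* [e] behaves like the rational [g] in the torsion-free module spanned by the conjugates of [c],
   where [conj_c k] corresponds to [slope_rat k]. *)
Definition slope_element (e : Q) (g : rat) :=
  [/\ g != 0%R, forall k, commute e (conj_c k)
    & forall k (X Y : int), (X%:~R * g = Y%:~R * slope_rat k)%R ->
        zpow e X = zpow (conj_c k) Y].

(** After conjugation only [kd] = k - k' and [c] have to be compared. In lowest terms the equation
    makes X and Y the same multiple of den / d and num / d, so the relations needed are exactly
    those with the gcd divided out. *)
Lemma conj_c_slope k : slope_element (conj_c k) (slope_rat k).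
Proof.
split=> [|k'|k' X Y XY]; [exact: slope_rat_neq0|exact: commute_conj_c|].
pose kd i := (k i - k' i)%R; set d := gcdz (den kd) (num kd).
have kE : slope_rat k = (slope_rat kd * slope_rat k')%R.
  by rewrite -slope_ratD; congr slope_rat; apply: funext => i; rewrite subrK.
have d0 : d != 0%R by rewrite gcdz_eq0 (negPf (den_neq0 kd)).
have XY' : (X%:~R * slope_rat kd = Y%:~R)%R.
  by apply: (mulIf (slope_rat_neq0 k')); rewrite -mulrA -kE.
have {}XY : (X * (num kd %/ d)%Z = Y * (den kd %/ d)%Z)%R.
  apply: (mulIf d0); rewrite -!mulrA !divzK ?dvdz_gcdl ?dvdz_gcdr //.
  by apply/eqP; rewrite -(eqr_int rat) !intrM -slope_ratE mulrA XY'.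
have cop : coprimez (den kd %/ d)%Z (num kd %/ d)%Z.
  rewrite /coprimez; apply/eqP; apply: (mulIf d0); rewrite mul1r.
  by rewrite -[X in (_ * X)%R]/(Posz `|d|) mulz_gcdl !divzK ?dvdz_gcdl ?dvdz_gcdr.
have /dvdzP[h XE] : ((den kd %/ d)%Z %| X)%Z.
  by rewrite -(Gauss_dvdzl _ cop) XY dvdz_mull.
have YE : Y = (h * (num kd %/ d)%Z)%R.
  apply: (mulIf (_ : (den kd %/ d)%Z != 0)%R); last by rewrite -XY XE mulrAC.
  apply/eqP => z0; have := den_neq0 kd.
  by rewrite -(divzK (dvdz_gcdl (den kd) (num kd))) -/d z0 mul0r eqxx.
have E : zpow (conj_c kd) (den kd %/ d)%Z = zpow c (num kd %/ d)%Z.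
  by rewrite /conj_c /cj -zpow_conj; exact: ratio_c.
rewrite XE YE -(conj_cB k k') -/kd -zpow_conj ![(h * _)%R]mulrC zpowM E -zpowM.
by rewrite zpow_conj.
Qed.

Lemma c_slope : slope_element c 1.
Proof.
have := conj_c_slope (fun=> 0%R); rewrite conj_c0.
suff -> : slope_rat (fun=> 0%R) = 1%R by [].
by rewrite /slope_rat big1 // => i _; rewrite expr0z.
Qed.

(** A Euclidean step: with g / mu = A / B in lowest terms, g and mu are the multiples A and B of mu
    / B, and Bezout coefficients express a generator through [e] and [conj_c k]. *)
Lemma slope_element_join e (g : rat) k : slope_element e g ->
  exists e' (g' : rat) A B, [/\ slope_element e' g', e = zpow e' A & conj_c k = zpow e' B].
Proof.
move=> [g0 eC eP]; set C := conj_c k; have [mu0 _ CP] := conj_c_slope k.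
set mu := slope_rat k in mu0 CP *.
pose A := numq (g / mu); pose B := denq (g / mu).
have B0 : (B%:~R != 0 :> rat)%R by rewrite intr_eq0 denq_neq0.
pose g' := (mu / B%:~R)%R.
have muE : mu = (B%:~R * g')%R by rewrite mulrC mulfVK.
have gE : g = (A%:~R * g')%R.
  by rewrite mulrCA -/(g / mu)%R divq_num_den mulrC mulfVK.
have /coprimezP[[al be] /= AB] : coprimez A B by exact: coprime_num_den.
have eB : zpow e B = zpow C A by apply: eP; rewrite gE -/mu muE mulrCA.
have comm l l' : commute (zpow e l) (zpow C l').
  by apply: zpow_commute; apply: commute_sym; apply: zpow_commute; apply: commute_sym; exact: eC.
have e'E l : zpow (zpow e al * zpow C be) l = zpow (zpow e l) al * zpow (zpow C l) be.
  by rewrite zpowMg // -!zpowM ![(_ * l)%R]mulrC.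
exists (zpow e al * zpow C be), g', A, B; split.
- split=> [|k'|k' X Y XY].
  + by rewrite mulf_neq0 ?invr_eq0.
  + by apply: commute_sym; apply: commuteM; apply: zpow_commute;
      [apply: commute_sym; exact: eC|exact: commute_conj_c].
  + rewrite e'E (eP k' X (A * Y)%R) ?(CP k' X (B * Y)%R).
    * rewrite -!zpowM -zpowD; congr zpow.
      by rewrite -[RHS]mulr1 -AB; ring.
    * by rewrite -/mu muE intrM mulrCA XY mulrA.
    * by rewrite gE intrM mulrCA XY mulrA.
- by rewrite e'E -eB -!zpowM -zpowD [(A * _)%R]mulrC [(B * _)%R]mulrC AB.
- by rewrite e'E eB -!zpowM -zpowD [(A * _)%R]mulrC [(B * _)%R]mulrC AB.
Qed.

Lemma slope_element_cyclic z : subgroup_gen (range conj_c) z ->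
  exists e A B, c = zpow e A /\ z = zpow e B.
Proof.
(* Quantifying over all slope elements [e] gives closure under products: the generator found for the
   first factor is fed to the second. *)
pose J := [set z | forall e (g : rat), slope_element e g -> exists e' (g' : rat) A B,
  [/\ slope_element e' g', e = zpow e' A & z = zpow e' B]]%classic.
have Jsub : is_subgroup J.
  split=> [e g he|z1 z2 h1 h2 e g he|z1 h1 e g he].
  - by exists e, g, 1%R, 0%R; rewrite zpow1.
  - have [e1 [g1 [A1 [B1 [he1 eE z1E]]]]] := h1 e g he.
    have [e2 [g2 [A2 [B2 [he2 e1E z2E]]]]] := h2 e1 g1 he1.
    exists e2, g2, (A2 * A1)%R, (A2 * B1 + B2)%R; split=> //.
      by rewrite zpowM -e1E.
    by rewrite zpowD zpowM -e1E -z1E -z2E.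
  - have [e1 [g1 [A1 [B1 [he1 eE z1E]]]]] := h1 e g he.
    by exists e1, g1, A1, (- B1)%R; rewrite zpowN -z1E.
move=> hz; have Jz : J z.
  apply: (subgroup_gen_sub Jsub) hz => _ [k _ <-] e g.
  exact: slope_element_join.
have [e [_ [A [B [_ cE zE]]]]] := Jz c 1%R c_slope.
by exists e, A, B.
Qed.

Local Notation S := (subgroup_gen (range conj_c)).

(** It serves to show that the preimage of the span in the HNN-extension is normal. Both
    conjugations are required so that inverses stay in the set. *)
Definition module_normalizer : set Q :=
  [set h | forall z, S z -> S (h * z * h^-1) /\ S (h^-1 * z * h)]%classic.

Lemma module_normalizer_subgroup : is_subgroup module_normalizer.
Proof.
split=> [z Sz|g h hg hh z Sz|g hg z Sz].
- by rewrite invg1 mul1g mulg1.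
- have [h1 _] := hh z Sz; have [_ h2] := hg z Sz.
  have [h3 _] := hg _ h1; have [_ h4] := hh _ h2.
  by move: h3 h4; rewrite invgM !mulgA.
- by rewrite invgK; case: (hg z Sz).
Qed.

Lemma module_normalizerP h :
  (forall k, S (h * conj_c k * h^-1) /\ S (h^-1 * conj_c k * h)) ->
  module_normalizer h.
Proof.
move=> H z; have Ss := subgroup_gen_subgroup (range conj_c); case: (Ss) => S1 SM SV.
pose N := [set z | S (h * z * h^-1) /\ S (h^-1 * z * h)]%classic.
suff [Ns NC] : is_subgroup N /\ (range conj_c `<=` N)%classic.
  exact: subgroup_gen_sub Ns NC z.
split; last by move=> _ [k _ <-]; exact: H.
split=> [|z1 z2 [h1 k1] [h2 k2]|z1 [h1 k1]]; rewrite /N /=.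
- by rewrite !mulg1 mulgV mulVg.
- by move: (SM _ _ h1 h2) (SM _ _ k1 k2); rewrite !mulgA mulgVK mulgK.
- by move: (SV _ h1) (SV _ k1); rewrite !invgM !invgK !mulgA.
Qed.

Lemma module_normalizer_x : module_normalizer x.
Proof.
apply: module_normalizerP => k; have xk := commute_x_conj_c k.
rewrite xk mulgK -mulgA -xk mulKg.
by split; apply: sub_subgroup_gen; exists k.
Qed.

Lemma module_normalizer_y i : module_normalizer (y i).
Proof.
have yE l : tprod y (fun j => if j == i then l else 0%R) = zpow (y i) l.
  rewrite /tprod (eq_bigr (fun j => if j == i then zpow (y i) l else 1)).
    by rewrite -big_mkcond big_pred1_eq.
  by move=> j _; case: eqP => // ->.
apply: module_normalizerP => k; split; apply: sub_subgroup_gen.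
  by exists (fun j => (if j == i then 1 else 0) + k j)%R; rewrite // conj_cD yE.
exists (fun j => (if j == i then (-1)%Z else 0) + k j)%R => //.
by rewrite conj_cD yE zpowN1 invgK.
Qed.

End ConjugationModule.

(** * The residual when every theta is infinite *)

Section ResidualInfiniteTheta.
Local Open Scope group_scope.
Variables (p r : nat) (n m : 'I_r -> int).
Hypothesis p_pr : prime p.
Local Notation G := (hnn n m).
Local Notation a := (hnn_a n m).
Local Notation t := (hnn_t n m).
Variables (sigma : 'I_r -> nat) (mh nh : 'I_r -> int).
Hypotheses (hm : forall i, m i = ((p ^ sigma i)%N%:Z * mh i)%R)
  (hn : forall i, n i = ((p ^ sigma i)%N%:Z * nh i)%R)
  (hpn : forall i, ~~ (p%:Z %| nh i)%Z)
  (hmn : forall i, (p%:Z %| (mh i - nh i)%R)%Z).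

(** Empty words suffice: [a] acts by translation by 1 and [t_i] by scaling modulo p^N, where p^N
    exceeds the absolute value of [z]. *)
Lemma a_zpow_residual z : p_residual G p (zpow a z) -> z = 0%R.
Proof.
move=> zres; pose N := `|z|.+1.
have q1 : (1 < p ^ N)%N by rewrite -(exp1n N) ltn_exp2r ?prime_gt1.
have [lam lamP] := choice (fun i => slope_exists p_pr (ltn0Sn `|z|) (hpn i) (hmn i)).
have [lamU lam1 lamE] : [/\ forall i, lam i \is a GRing.unit,
    forall i, one_mod_p p (lam i) & forall i, (lam i * (1 *~ n i) = 1 *~ m i)%R].
  split=> i; case: (lamP i) => // _ _ e.
  by rewrite hm hn !intrM mulrCA e.
have pN0 : ((p ^ N)%:R = 0 :> 'Z_(p ^ N))%R.
  by apply/eqP; rewrite (Zp_int_eq0 (p ^ N)%N%:Z) // dvdzz.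
have [F [FM Fa Ft Fres]] := @representation_exists _ _ 0 _ (fun=> 0%N) _ lamU _ _ lamE
  (fun i => mulr0n _) _ _ (prime_gt0 p_pr) pN0 p_pr lam1.
have Fz := Fres _ zres; rewrite (morphg_zpow FM) Fa in Fz.
have [|_] := @syl_eval_eq1 _ _ 0 _ (fun=> 0%N) _ lamU (fun _ _ => true)
  (fun _ _ _ => isT) [::] z isT isT _ Fz.
  by rewrite big_nil oner_neq0.
move/eqP; rewrite Zp_int_eq0 // dvdzE /= => pz.
apply/eqP; rewrite -absz_eq0 eqn0Ngt; apply/negP => z0.
have := dvdn_leq z0 pz; rewrite leqNgt => /negP; apply.
by apply: leq_trans (ltn_expl _ (prime_gt1 p_pr)) _; rewrite leq_exp2l ?prime_gt1.
Qed.

Variables (q : nat) (u v : 'I_r -> int).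
Hypotheses (q0 : (0 < q)%N) (u0 : forall i, u i != 0%R) (v0 : forall i, v i != 0%R).
Local Notation gens := (gens_a a t q `|` gens_b a t q `|` gens_c a t q u v)%classic.
Hypothesis gens_res : (gens `<=` p_residual G p)%classic.
Hypothesis res_sub : (p_residual G p `<=` normal_closure [set a ^+ q])%classic.

Lemma p_residual_eq_gens : p_residual G p = normal_closure gens.
Proof.
set K := normal_closure _; have Kn : is_normal K by exact: normal_closure_normal.
have resn := p_residual_normal p G.
have Kres : (K `<=` p_residual G p)%classic by exact: normal_closure_sub.
apply/seteqP; split=> // g gres.
have [Q [f [fM fS fK]]] := quotient_exists Kn.
have gK z : gens z -> f z = 1 by move=> gz; apply/fK; exact: sub_normal_closure.
pose x := f a; pose y i := f (t i).
have fT k : f (tprod t k) = tprod y k.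
  rewrite /tprod (big_morph f fM (morphg1 fM)).
  by apply: eq_bigr => i _; exact: morphg_zpow.
have fc : f (a ^+ q) = x ^+ q by exact: morphgX.
have Fimage : (subgroup_gen (range y) `<=` [set f g | g in subgroup_gen (range t)])%classic.
  have [S1 SM SV] := subgroup_gen_subgroup (range t).
  apply: subgroup_gen_sub.
    split=> [|_ _ [g1 h1 <-] [g2 h2 <-]|_ [g1 h1 <-]].
    - by exists 1; rewrite ?(morphg1 fM).
    - by exists (g1 * g2); [exact: SM|exact: fM].
    - by exists g1^-1; [exact: SV|exact: morphgV].
  by move=> _ [i _ <-]; exists (t i) => //; apply: sub_subgroup_gen; exists i.
have derived_c g1 g2 : subgroup_gen (range y) g1 -> subgroup_gen (range y) g2 ->
    commute [~ g1, g2] (x ^+ q).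
  move=> /Fimage[h1 Fh1 <-] /Fimage[h2 Fh2 <-].
  apply/commgP/eqP; rewrite -fc -!(morphgR fM); apply: gK; left; left.
  exists [~ h1, h2] => //; apply: sub_subgroup_gen.
  by exists h1 => //; exists h2.
have conj_x_c k : commute (tprod y k * x * (tprod y k)^-1) (x ^+ q).
  apply/commgP/eqP; rewrite -fT -(morphg_conj fM) -fc -(morphgR fM).
  by apply: gK; left; right; exists k.
have qE z : zpow (x ^+ q) z = f (zpow a (q%:Z * z)%R).
  by rewrite (morphg_zpow fM) zpowM.
have ratio_c k : tprod y k * zpow (x ^+ q) ((\prod_(i < r) ysel (u i) (v i) (k i))
      %/ gcdz (\prod_(i < r) ysel (u i) (v i) (k i))
              (\prod_(i < r) ysel (v i) (u i) (k i)))%Z * (tprod y k)^-1 =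
    zpow (x ^+ q) ((\prod_(i < r) ysel (v i) (u i) (k i))
      %/ gcdz (\prod_(i < r) ysel (u i) (v i) (k i))
              (\prod_(i < r) ysel (v i) (u i) (k i)))%Z.
  rewrite !qE -fT -(morphg_conj fM); apply/eqP.
  rewrite -[f (zpow _ _)]invgK -mulg_eq1 -(morphgV fM) -fM -zpowN.
  by apply/eqP; apply: gK; right; exists k.
pose S := subgroup_gen (range (conj_c q x y)).
(* This normal subgroup contains a^q, hence the whole residual. *)
have Sn : is_normal [set z | S (f z)]%classic.
  have Ss : is_subgroup S by exact: subgroup_gen_subgroup.
  case: (Ss) => S1 SM SV; split.
    split=> [|z1 z2 h1 h2|z1 h1] /=; rewrite ?(morphg1 fM) ?fM ?(morphgV fM) //.
      exact: SM.
    exact: SV.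
  move=> h z Sz /=; rewrite (morphg_conj fM).
  have : module_normalizer q x y (f h).
    apply: (hnn_morph_ext fM); first exact: module_normalizer_subgroup.
      exact: module_normalizer_x.
    by move=> i; exact: module_normalizer_y.
  by case/(_ _ Sz).
have Sg : S (f g).
  apply: (normal_closure_sub Sn) (res_sub gres) => _ -> /=.
  by rewrite fc -(conj_c0 q x y); apply: sub_subgroup_gen; exists (fun=> 0%R).
have [e [A [B [cE gE]]]] :=
  slope_element_cyclic u0 v0 derived_c conj_x_c ratio_c Sg.
(* Both g^A and a^(q B) map to e^(A B). As [K] lies in the residual, so does a^(q B), which forces B
   = 0. *)
have KAB : K (zpow g A * (zpow a (q%:Z * B)%R)^-1).
  apply/fK; rewrite fM (morphgV fM) -qE (morphg_zpow fM) gE cE -!zpowM mulrC.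
  exact: mulgV.
have aB : p_residual G p (zpow a (q%:Z * B)%R).
  case: (resn) => rs _; case: (rs) => _ rM rV.
  have := rM _ _ (rV _ (Kres _ KAB)) (subgroup_zpow A rs gres).
  by rewrite invgM invgK mulgVK.
have /eqP := a_zpow_residual aB; rewrite mulf_eq0 eqz_nat eqn0Ngt q0 /= => /eqP B0.
by apply/fK; rewrite gE B0.
Qed.

End ResidualInfiniteTheta.

(** * Assembly of the two cases *)

Theorem mainTheorem1 (p r : nat) (hp : prime p) (hr : (1 <= r)%N)
  (n m : 'I_r -> int)
  (hn0 : forall i, n i <> 0%R) (hm0 : forall i, m i <> 0%R)
  (hnm : forall i, (0 < n i <= `|m i|)%R)
  (hnm1 : forall i, (n i, `|m i|%R) <> (1%R, 1%R))
  (sigma tau : 'I_r -> nat) (mh nh : 'I_r -> int)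
  (hm : forall i, m i = ((p ^ sigma i)%N%:Z * mh i)%R)
  (hn : forall i, n i = ((p ^ tau i)%N%:Z * nh i)%R)
  (hpm : forall i, ~~ (p%:Z %| mh i)%Z)
  (hpn : forall i, ~~ (p%:Z %| nh i)%Z)
  (d u v : 'I_r -> int)
  (hd : forall i, d i = gcdz (mh i) (nh i))
  (hu : forall i, mh i = (d i * u i)%R)
  (hv : forall i, nh i = (d i * v i)%R) :
  let G := hnn n m in
  let a : G := hnn_a n m in
  let t : 'I_r -> G := hnn_t n m in
  let th i := theta p (sigma i) (tau i) (mh i) (nh i) in
  let Sigma := (\sum_(i < r) sigma i)%N in
  ((exists i, th i <> None) ->
     exists xi : nat, is_min_theta th xi /\
       p_residual G p = normal_closure [set (a ^+ (p ^ xi))%g]%classic) /\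
  ((forall i, th i = None) ->
     p_residual G p =
       normal_closure
         (gens_a a t (p ^ Sigma) `|` gens_b a t (p ^ Sigma)
          `|` gens_c a t (p ^ Sigma) u v)%classic).
Proof.
move=> G a t th Sigma; split=> [[i0 thi0]|th0].
  have exj : exists j, [exists i, th i == Some j].
    by case E: (th i0) thi0 => [j|] // _; exists j; apply/existsP; exists i0; rewrite E.
  pose xi := ex_minn exj.
  have [[i1 thi1] xi_min] : (exists i, th i = Some xi) /\
      forall i j, th i = Some j -> (xi <= j)%N.
    rewrite /xi; case: ex_minnP => k /existsP[i /eqP ik] kmin.
    split; first by exists i.
    by move=> i' j e; apply: kmin; apply/existsP; exists i'; rewrite e.
  exists xi; split; first by split=> //; exists i1.
  apply/seteqP; split.
    (* If xi is at most both valuations, the relation is trivial modulo a^(p^xi). Otherwise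
       minimality of xi makes theta_i infinite, and the common valuation serves as [c i]. *)
    move=> g; apply: (@p_residual_sub_closure p r n m hp xi
      (fun i => minn xi (minn (sigma i) (tau i)))) => i; first exact: geq_minl.
    have dvd_pow k l z : (k <= l)%N -> ((p ^ k)%N%:Z %| ((p ^ l)%N%:Z * z)%R)%Z.
      by move=> kl; rewrite dvdz_mulr // dvdzE /= dvdn_exp2l.
    have [xi_le|lt_xi] := leqP xi (minn (sigma i) (tau i)).
      left; split; rewrite ?(minn_idPl xi_le) // ?hn ?hm; apply: dvd_pow;
      by apply: leq_trans xi_le _; rewrite ?geq_minl ?geq_minr.
    have thi : th i = None.
      case E: (th i) => [j|] //; have := xi_min _ _ E; rewrite leqNgt.
      move: E; rewrite /th /theta; case: ifP => // _ [<-].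
      by rewrite lt_xi.
    have [st pmn] := theta_None thi; right; exists (nh i), (mh i).
    by rewrite /= !st !minnn hn hm st.
  apply: normal_closure_sub; first exact: p_residual_normal.
  by move=> _ ->; exact: (theta_residual hp hm hn hpm hpn thi1).
have st i : sigma i = tau i by case: (theta_None (th0 i)).
have hmn i : (p%:Z %| (mh i - nh i)%R)%Z by case: (theta_None (th0 i)).
have hn' i : n i = ((p ^ sigma i)%N%:Z * nh i)%R by rewrite st.
apply: (p_residual_eq_gens hp hm hn' hpn hmn).
- by rewrite expn_gt0 prime_gt0.
- by move=> i; apply: contra_not_neq (hm0 i) => ui; rewrite hm hu ui !mulr0.
- by move=> i; apply: contra_not_neq (hn0 i) => vi; rewrite hn hv vi !mulr0.
- exact: (gens_residual hp hm hn hpm hpn th0 hu hv).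
- move=> g; apply: (p_residual_sub_closure hp) => i; first exact: sigma_le_sum.
  by right; exists (nh i), (mh i).
Qed.
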